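(* Let $\mathcal{G}_h$ be a rectangular grid of $\Omega$, let $V_{h0}^{\rm R}$ be the reduced rectangular Morley space on $\mathcal{G}_h$ with the basis $\{\varphi_K\}_{K\in\mathcal{K}_h^i}$ defined in the context. Let $\{\mathcal{D}_K\}_{K\in\mathcal{K}_h^i}$ be a set of subdomains of $\Omega$ and let $\{\lambda_K^{\rm d}\}_{K\in\mathcal{K}_h^i}$ be linear functionals such that $\lambda_K^{\rm d}(v)$ is computed with the information of $v$ within $\mathcal{D}_K$. Define the interpolation operator $$\Pi_h^{\rm d}v=\sum_{K\in\mathcal{K}_h^i}\lambda_K^{\rm d}(v)\,\varphi_K .$$ If there exists some $K_0\in\mathcal{K}_h^i$ such that $\mathcal{D}_{K_0}$ is a completely subdomain of $\Omega$ (defined in the context), then $\Pi_h^{\rm d}$ cannot be a projection satisfying $\Pi_h^{\rm d}(V_{h0}^{\rm R})=V_{h0}^{\rm R}$; that is, it is not the case that $\Pi_h^{\rm d}w=w$ for all $w\in V_{h0}^{\rm R}$.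
   Context: $\Omega\subset\mathbb{R}^2$ is a simply connected polygon that can be covered by a rectangular subdivision; $\mathcal{G}_h$ is a subdivision of $\Omega$ into rectangles with sides parallel to the axes (without hanging nodes). A corner node is a boundary vertex that is the intersection of two boundary edges not on the same line; it is assumed that no two corner nodes lie in the same cell. A cell is interior if none of its vertices is on $\partial\Omega$; $\mathcal{K}_h^i$ is the set of interior cells. $L_K,H_K$ are the lengths of $K$ in the $x$ and $y$ directions. RRM space. For a rectangular grid $\mathcal{G}$ of a domain $D$, $V_{h0}^{\rm R}(\mathcal{G})$ is the set of $w\in L^2(D)$ such that: $w|_K\in P_2(K)$ (total degree at most 2) for each $K\in\mathcal{G}$; $w$ is continuous at all interior vertices; $\fint_e\partial_{\mathbf{n}_e}w\,ds$ is continuous across each interior edge $e$; $w$ vanishes at all boundary vertices; and $\fint_e\partial_{\mathbf{n}_e}w\,ds=0$ for each boundary edge $e$ ($\fint$ is the integral mean). $V_{h0}^{\rm R}=V_{h0}^{\rm R}(\mathcal{G}_h)$. Basis. For $K\in\mathcal{K}_h^i$, $\mathcal{M}_K$ is the $3\times3$ patch of cells centered at $K$, with column widths $L_{K,-1},L_K,L_{K,1}$ (left to right) and row heights $H_{K,-1},H_K,H_{K,1}$ (bottom to top). $V_{h0}^{\rm R}(\mathcal{M}_K)$ is one-dimensional; $\varphi_K$ vanishes outside $\mathcal{M}_K$, restricts to an element of $V_{h0}^{\rm R}(\mathcal{M}_K)$, and has value $\frac{L_{K,-1}}{L_{K,-1}+L_K}\cdot\frac{H_{K,-1}}{H_{K,-1}+H_K}$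 at the lower-left vertex of $K$. The functions $\{\varphi_K\}_{K\in\mathcal{K}_h^i}$ form a basis of $V_{h0}^{\rm R}$. A subdomain $\omega$ of $\Omega$ is called a completely subdomain if it is a (nonempty) union of cells of $\mathcal{G}_h$ and each cell in $\omega$ is located in the supports of nine of the basis functions $\varphi_K$, $K\in\mathcal{K}_h^i$. ''Computed with the information of $v$ within $\mathcal{D}_K$'' means $\lambda_K^{\rm d}(v)=\lambda_K^{\rm d}(w)$ whenever $v|_{\mathcal{D}_K}=w|_{\mathcal{D}_K}$; the functionals are defined on a space of functions containing $V_{h0}^{\rm R}$. *)

(* Defs.v *)
From HB Require Import structures.
From mathcomp Require Import all_boot all_order all_algebra.
From mathcomp Require Import all_classical all_reals all_analysis.

Set Implicit Arguments.
Unset Strict Implicit.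
Unset Printing Implicit Defensive.

Import Order.TTheory GRing.Theory Num.Theory.
Import numFieldNormedType.Exports.

Local Open Scope classical_set_scope.
Local Open Scope ring_scope.

(* Lebesgue measure on the plane *)
Definition leb2 (R : realType) :
    {measure set (measurableTypeR R * measurableTypeR R)%type -> \bar R} :=
  (lebesgue_measure \x lebesgue_measure)%E.

Section PlaneDomains.
Variable R : realType.
Implicit Types (A Omega : set (R * R)) (s : seq (R * R)).

Definition frontier A : set (R * R) := closure A `\` A°.

(* The closed polygonal line with successive vertices s_0, ..., s_(n-1), s_0:
   polyline_pt s i t runs over the i-th side as t runs from 0 to 1. *)
Definition polyline_pt s (i : nat) (t : R) : R * R :=
  (1 - t) *: s`_i + t *: s`_(i.+1 %% size s).

Definition closed_polyline s : set (R * R) :=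
  [set z | exists i t,
     [/\ (i < size s)%N, 0 <= t, t < 1 & z = polyline_pt s i t]].

(* Half-open sides make each point of a simple closed line have exactly one
   parameter (i, t); in particular consecutive vertices are distinct. *)
Definition simple_closed_polyline s : Prop :=
  (0 < size s)%N /\
  forall i j (t u : R), (i < size s)%N -> (j < size s)%N ->
    0 <= t < 1 -> 0 <= u < 1 ->
    polyline_pt s i t = polyline_pt s j u -> i = j /\ t = u.

(* A bounded domain lying on one side of its boundary, which consists of
   finitely many disjoint simple closed polygonal lines (holes are only
   excluded by simple connectedness, required separately). *)
Definition polygonal_domain Omega : Prop :=
  [/\ open Omega, Omega !=set0, bounded_set Omega, connected Omega &
      (closure Omega)° = Omega /\
      exists cs : seq (seq (R * R)),
        [/\ forall k, (k < size cs)%N -> simple_closed_polyline (nth [::] cs k),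
            forall k l, (k < size cs)%N -> (l < size cs)%N -> k <> l ->
              closed_polyline (nth [::] cs k) `&`
              closed_polyline (nth [::] cs l) = set0 &
            frontier Omega =
              [set z | exists2 k, (k < size cs)%N &
                         closed_polyline (nth [::] cs k) z]]].

(* Path connected, and every loop is homotopic to a constant loop relative to
   its base point. *)
Definition simply_connected Omega : Prop :=
  (forall a b, Omega a -> Omega b ->
     exists g : R -> R * R,
       [/\ {within `[0, 1], continuous g}, g @` `[0, 1] `<=` Omega,
           g 0 = a & g 1 = b]) /\
  (forall g : R -> R * R,
     {within `[0, 1], continuous g} -> g @` `[0, 1] `<=` Omega -> g 0 = g 1 ->
     exists H : R * R -> R * R,
       [/\ {within `[0, 1] `*` `[0, 1], continuous H},
           H @` (`[0, 1] `*` `[0, 1]) `<=` Omega,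
           forall t : R, 0 <= t <= 1 -> H (0, t) = g t,
           forall t : R, 0 <= t <= 1 -> H (1, t) = g 0 &
           forall u : R, 0 <= u <= 1 -> H (u, 0) = g 0 /\ H (u, 1) = g 0]).

End PlaneDomains.

(* The closed rectangle [xl, xr] x [yb, yt] *)
Record rect (R : realType) := Rect { xl : R; xr : R; yb : R; yt : R }.

(* VEdge x c d is {x} x [c, d], HEdge y a b is [a, b] x {y}. *)
Inductive edge (R : realType) :=
  | VEdge of R & R & R
  | HEdge of R & R & R.

Section Grids.
Variable R : realType.
Implicit Types (Q : rect R) (e : edge R) (z : R * R) (f : R * R -> R).

Definition rect_set Q : set (R * R) := `[xl Q, xr Q] `*` `[yb Q, yt Q].

Definition rlen Q : R := xr Q - xl Q.
Definition rheight Q : R := yt Q - yb Q.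

Definition is_vertex Q z : Prop :=
  (z.1 = xl Q \/ z.1 = xr Q) /\ (z.2 = yb Q \/ z.2 = yt Q).

Definition edge_set e : set (R * R) :=
  match e with
  | VEdge x c d => [set x] `*` `[c, d]
  | HEdge y a b => `[a, b] `*` [set y]
  end.

Definition is_edge Q e : Prop :=
  [\/ e = VEdge (xl Q) (yb Q) (yt Q), e = VEdge (xr Q) (yb Q) (yt Q),
      e = HEdge (yb Q) (xl Q) (xr Q) | e = HEdge (yt Q) (xl Q) (xr Q)].

(* Mean over e of the derivative of f along the unit normal of e, oriented as
   (1, 0) on vertical and as (0, 1) on horizontal edges. *)
Definition mean_dn e f : R :=
  match e with
  | VEdge x c d =>
      (d - c)^-1 * \int[lebesgue_measure]_(y in `[c, d])
                     ('D_((1, 0) : R * R) f (x, y))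
  | HEdge y a b =>
      (b - a)^-1 * \int[lebesgue_measure]_(x in `[a, b])
                     ('D_((0, 1) : R * R) f (x, y))
  end.

Definition is_P2 f : Prop :=
  exists c : nat -> nat -> R, forall z,
    f z = \sum_(i < 3) \sum_(j < 3 | (i + j <= 2)%N)
            c i j * z.1 ^+ i * z.2 ^+ j.

Variables (T : finType) (cell : T -> rect R).
Implicit Types (K : T) (D Omega omega : set (R * R)).

(* The absence of hanging nodes: a vertex of one cell lying in another cell is
   a vertex of the latter. *)
Definition rectangular_grid Omega : Prop :=
  [/\ forall K, xl (cell K) < xr (cell K) /\ yb (cell K) < yt (cell K),
      closure Omega = \bigcup_K rect_set (cell K),
      forall K K', K <> K' ->
        (rect_set (cell K))° `&` (rect_set (cell K'))° = set0 &
      forall K K' z, is_vertex (cell K) z -> rect_set (cell K') z ->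
        is_vertex (cell K') z].

Definition corner_node Omega z : Prop :=
  (exists2 K, is_vertex (cell K) z & frontier Omega z) /\
  exists K x c d K' y a b,
    [/\ is_edge (cell K) (VEdge x c d) /\ is_edge (cell K') (HEdge y a b),
        edge_set (VEdge x c d) `<=` frontier Omega,
        edge_set (HEdge y a b) `<=` frontier Omega &
        edge_set (VEdge x c d) `&` edge_set (HEdge y a b) = [set z]].

Definition corner_separated Omega : Prop :=
  forall K z z', corner_node Omega z -> corner_node Omega z' ->
    rect_set (cell K) z -> rect_set (cell K) z' -> z = z'.

Definition interior_cell Omega K : Prop :=
  forall z, is_vertex (cell K) z -> ~ frontier Omega z.

(* w belongs to the reduced rectangular Morley space on the domain D gridded by
   the cells of G, and p K is the quadratic polynomial with which w coincides
   (a.e.) on the cell K: one-sided vertex values and edge means of w are those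
   of the p K. *)
Definition RRM_pieces D (G : set T) (w : R * R -> R) (p : T -> R * R -> R) :
    Prop :=
  [/\ measurable_fun (D : set (measurableTypeR R * measurableTypeR R)%type) w /\
        (\int[leb2 R]_(z in D) ((w z) ^+ 2)%:E < +oo)%E,
      forall K, G K -> is_P2 (p K) /\ ae_eq (leb2 R) (rect_set (cell K)) w (p K),
      forall z, ~ frontier D z -> forall K K', G K -> G K' ->
        is_vertex (cell K) z -> is_vertex (cell K') z -> p K z = p K' z,
      forall e, ~ (edge_set e `<=` frontier D) -> forall K K', G K -> G K' ->
        is_edge (cell K) e -> is_edge (cell K') e ->
        mean_dn e (p K) = mean_dn e (p K') &
      (forall z, frontier D z -> forall K, G K -> is_vertex (cell K) z ->
         p K z = 0) /\
      (forall e, edge_set e `<=` frontier D -> forall K, G K ->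
         is_edge (cell K) e -> mean_dn e (p K) = 0)].

Definition RRM D (G : set T) : set (R * R -> R) :=
  [set w | exists p, RRM_pieces D G w p].

Definition left_of K K' : Prop :=
  [/\ xr (cell K) = xl (cell K'), yb (cell K) = yb (cell K') &
      yt (cell K) = yt (cell K')].

Definition below K K' : Prop :=
  [/\ yt (cell K) = yb (cell K'), xl (cell K) = xl (cell K') &
      xr (cell K) = xr (cell K')].

(* M i j (i, j < 3) is the cell in column i (from the left) and row j (from the
   bottom) of the 3 x 3 patch centered at K. *)
Definition is_patch K (M : nat -> nat -> T) : Prop :=
  [/\ M 1%N 1%N = K,
      forall i j, (i < 2)%N -> (j < 3)%N -> left_of (M i j) (M i.+1 j) &
      forall i j, (i < 3)%N -> (j < 2)%N -> below (M i j) (M i j.+1)].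

Definition patch_cells (M : nat -> nat -> T) : set T :=
  [set K | exists i j, [/\ (i < 3)%N, (j < 3)%N & K = M i j]].

Definition patch_domain (M : nat -> nat -> T) : set (R * R) :=
  \bigcup_(K in patch_cells M) rect_set (cell K).

(* The Morley space of a 3 x 3 patch is one-dimensional, so these conditions
   determine phi up to a.e. equality. *)
Definition is_RRM_basis_fun K (phi : R * R -> R) : Prop :=
  exists M, is_patch K M /\
  let LK := rlen (cell K) in let HK := rheight (cell K) in
  let Lleft := rlen (cell (M 0%N 1%N)) in
  let Hbelow := rheight (cell (M 1%N 0%N)) in
  (forall z, ~ patch_domain M z -> phi z = 0) /\
  exists p, RRM_pieces (patch_domain M) (patch_cells M) phi p /\
    p K (xl (cell K), yb (cell K)) =
      Lleft / (Lleft + LK) * (Hbelow / (Hbelow + HK)).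

Variable phi : T -> R * R -> R.

Definition support_fun (f : R * R -> R) : set (R * R) :=
  closure [set z | f z != 0].

Definition completely_subdomain Omega omega : Prop :=
  exists S : {set T},
    [/\ S != finset.set0, omega = \bigcup_(K in [set` S]) rect_set (cell K) &
        forall K, K \in S ->
          #|[set K' | `[< interior_cell Omega K' /\
               rect_set (cell K) `<=` support_fun (phi K') >]]%SET| = 9%N].

Definition interpolation Omega (lambda : T -> (R * R -> R) -> R)
    (v : R * R -> R) : R * R -> R :=
  fun z => \sum_(K | `[< interior_cell Omega K >]) lambda K v * phi K z.

End Grids.

Section FunctionSpaces.
Variable R : realType.
Implicit Types (X : set (R * R -> R)) (l : (R * R -> R) -> R).

Definition is_linear_space X : Prop :=
  X (fun=> 0) /\
  forall (a : R) v w, X v -> X w -> X (fun z => a * v z + w z).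

Definition linear_on X l : Prop :=
  forall (a : R) v w, X v -> X w ->
    l (fun z => a * v z + w z) = a * l v + l w.

(* l v depends only on the restriction of v (as a class modulo a.e. equality)
   to D. *)
Definition determined_on X (D : set (R * R)) l : Prop :=
  forall v w, X v -> X w -> ae_eq (leb2 R) D v w -> l v = l w.

End FunctionSpaces.

(* Main.v *)
(** On its 3 x 3 patch, the basis function of a cell K has the vertex values of
    the tensor product of the two quadratic B-splines with the column and row
    lines of the patch as knots, and its edge means are those of a function
    that is linear along each edge. Color the cells like a checkerboard, which
    simple connectivity of Omega makes possible, and give K the coefficient
    ± |K|. On a cell lying in nine supports, the vertex values and edge means of
    the resulting combination f factor into alternating sums of B-splines
    weighted by their middle knot intervals; these vanish at the knots, so f = 0
    on the complete subdomain D K0, and lambda K0 f = 0 by locality. A projection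
    would force the functionals lambda K to be dual to the basis, hence
    lambda K0 f = ± |K0|, a contradiction. *)

Require Import Defs.
From HB Require Import structures.
From mathcomp Require Import all_boot all_order all_algebra.
From mathcomp Require Import all_classical all_reals all_analysis.
From mathcomp Require Import ring lra zify.
Import Order.TTheory GRing.Theory Num.Theory.
Import numFieldNormedType.Exports.
Local Open Scope classical_set_scope.
Local Open Scope ring_scope.

Set Implicit Arguments.
Unset Strict Implicit.
Unset Printing Implicit Defensive.

(** * Quadratic polynomials and their edge means *)

Section Quadratics.
Variable R : realType.
Implicit Types (p : R * R -> R).

(** The weights come from one dimension. At a knot between intervals of lengths p and q, two of the
    quadratic B-splines are nonzero: the one with middle interval of length p takes the value q / (p
    + q), the other p / (p + q). Hence weights p and -q cancel, and up to scale only alternating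
    middle lengths cancel at every knot; the product of both directions is ± |K|. The slopes at the
    knots do not cancel. The relation holds because a Morley function sees only edge means of normal
    derivatives, where the slope across an edge is multiplied by the average of the end values along
    it, and that factor does cancel. The obstacle is the sign: around a hole, the numbers of columns
    passed above and below may differ by an odd number, so that no alternating sign exists. Locally
    the change of sign is a cocycle on cells through a common point; contracting loops makes it
    consistent globally. Members of the space are classes modulo null sets, so vertex values and
    edge means are always read off the polynomial pieces. *)

Definition quad (a b g d e h : R) : R * R -> R := fun z =>
  a + b * z.1 + g * z.2 + d * z.1 ^+ 2 + e * z.1 * z.2 + h * z.2 ^+ 2.

Lemma is_P2_quad p : is_P2 p -> exists a b g d e h, p = quad a b g d e h.
Proof.
case=> c pE; exists (c 0%N 0%N), (c 1%N 0%N), (c 0%N 1%N), (c 2%N 0%N),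
  (c 1%N 1%N), (c 0%N 2%N).
apply/funext => z; rewrite pE /quad.
rewrite 3!big_ord_recl big_ord0 /= /bump /= !addn0 !add1n.
do 3 (rewrite big_mkcond /= 3!big_ord_recl big_ord0 /= /bump /= ?add1n /=).
by ring.
Qed.

Lemma quad_is_P2 a b g d e h : is_P2 (quad a b g d e h).
Proof.
exists (fun i j => match i, j with
  | 0%N, 0%N => a | 1%N, 0%N => b | 0%N, 1%N => g | 2%N, 0%N => d
  | 1%N, 1%N => e | 0%N, 2%N => h | _, _ => 0 end) => z; rewrite /quad.
rewrite 3!big_ord_recl big_ord0 /= /bump /= !addn0 !add1n.
do 3 (rewrite big_mkcond /= 3!big_ord_recl big_ord0 /= /bump /= ?add1n /=).
by ring.
Qed.

Lemma is_P2_0 : is_P2 (fun=> 0 : R).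
Proof.
have -> : (fun=> 0 : R) = quad 0 0 0 0 0 0.
  by apply/funext => z; rewrite /quad; ring.
exact: quad_is_P2.
Qed.

Lemma is_P2_lincomb (a : R) p q : is_P2 p -> is_P2 q ->
  is_P2 (fun z => a * p z + q z).
Proof.
move=> [c cE] [c' c'E]; exists (fun i j => a * c i j + c' i j) => z.
rewrite cE c'E mulr_sumr -big_split /=; apply: eq_bigr => i _.
rewrite mulr_sumr -big_split /=; apply: eq_bigr => j _; ring.
Qed.

Lemma is_P2_sum (I : Type) (r : seq I) (P : pred I) (c : I -> R)
    (q : I -> R * R -> R) : (forall i, P i -> is_P2 (q i)) ->
  is_P2 (fun z => \sum_(i <- r | P i) c i * q i z).
Proof.
move=> qP; elim: r => [|i r IH].
  rewrite (_ : (fun z => _) = fun=> 0); first exact: is_P2_0.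
  by apply/funext => z; rewrite big_nil.
case: (boolP (P i)) => Pi; last first.
  rewrite (_ : (fun z => _) = fun z => \sum_(j <- r | P j) c j * q j z) //.
  by apply/funext => z; rewrite big_cons (negPf Pi).
rewrite (_ : (fun z => _) =
  fun z => c i * q i z + \sum_(j <- r | P j) c j * q j z).
  by apply: is_P2_lincomb => //; exact: qP.
by apply/funext => z; rewrite big_cons Pi.
Qed.

Lemma derive_quad_x a b g d e h x y :
  'D_((1, 0) : R * R) (quad a b g d e h) (x, y) = b + 2 * d * x + e * y.
Proof.
apply: cvg_lim => //.
have : (b + 2 * d * x + e * y) + d * t @[t --> (0 : R)^'] -->
    (b + 2 * d * x + e * y).
  rewrite -[X in _ --> X]addr0 -[X in _ --> _ + X](mulr0 d).
  apply: cvgD; first exact: cvg_cst.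
  apply: cvgM; [exact: cvg_cst | exact: nbhs_dnbhs].
apply: cvg_trans; apply: near_eq_cvg; near=> t.
have t0 : t != 0 by near: t; exact: nbhs_dnbhs_neq.
rewrite /quad /= !scaler1 !scaler0 /GRing.scale /=.
by field.
Unshelve. all: by end_near. Qed.

Lemma derive_quad_y a b g d e h x y :
  'D_((0, 1) : R * R) (quad a b g d e h) (x, y) = g + 2 * h * y + e * x.
Proof.
apply: cvg_lim => //.
have : (g + 2 * h * y + e * x) + h * t @[t --> (0 : R)^'] -->
    (g + 2 * h * y + e * x).
  rewrite -[X in _ --> X]addr0 -[X in _ --> _ + X](mulr0 h).
  apply: cvgD; first exact: cvg_cst.
  apply: cvgM; [exact: cvg_cst | exact: nbhs_dnbhs].
apply: cvg_trans; apply: near_eq_cvg; near=> t.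
have t0 : t != 0 by near: t; exact: nbhs_dnbhs_neq.
rewrite /quad /= !scaler1 !scaler0 /GRing.scale /=.
by field.
Unshelve. all: by end_near. Qed.

Lemma Rintegral_affine (u v c d : R) : c < d ->
  \int[lebesgue_measure]_(y in `[c, d]) (u + v * y) =
  (d - c) * (u + v * ((c + d) / 2)).
Proof.
move=> cd; rewrite /Rintegral.
rewrite (@continuous_FTC2 _ (fun y => u + v * y)
  (fun y => u * y + v / 2 * y ^+ 2)) //.
- by rewrite -EFinB /=; field.
- apply: continuous_subspaceT => y.
  apply: continuousD; first exact: cst_continuous.
  by apply: continuousM; [exact: cst_continuous | exact: cvg_id].
- have dF y : derivable (fun y => u * y + v / 2 * y ^+ 2 : R) y 1.
    by apply: derivableD; apply: derivableM.
  have cF : continuous (fun y => u * y + v / 2 * y ^+ 2 : R).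
    by move=> y; apply/differentiable_continuous/derivable1_diffP.
  split => //.
  + by apply: cvg_at_right_filter; exact: cF.
  + by apply: cvg_at_left_filter; exact: cF.
- move=> y _; rewrite derive1E.
  have -> : (fun y => u * y + v / 2 * y ^+ 2 : R) =
      (u \*: id + (v / 2) \*: (id ^+ 2) : R -> R) by apply/funext => t.
  rewrite deriveD // !deriveZ //= deriveX //.
  rewrite derive_id /GRing.scale /=; by field.
Qed.

(* The mean of the normal derivative of a quadratic is its value at the
   midpoint, where it is a symmetric difference quotient. *)
Lemma mean_dn_VEdge p x c d : is_P2 p -> c < d ->
  mean_dn (VEdge x c d) p =
  (p (x + 1, (c + d) / 2) - p (x - 1, (c + d) / 2)) / 2.
Proof.
move=> /is_P2_quad[a [b [g [k [e [h ->]]]]]] cd /=.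
under eq_Rintegral do rewrite derive_quad_x.
rewrite Rintegral_affine // /quad /=; field.
by rewrite subr_eq0 gt_eqF.
Qed.

Lemma mean_dn_HEdge p y c d : is_P2 p -> c < d ->
  mean_dn (HEdge y c d) p =
  (p ((c + d) / 2, y + 1) - p ((c + d) / 2, y - 1)) / 2.
Proof.
move=> /is_P2_quad[a [b [g [k [e [h ->]]]]]] cd /=.
under eq_Rintegral do rewrite derive_quad_y.
rewrite Rintegral_affine // /quad /=; field.
by rewrite subr_eq0 gt_eqF.
Qed.

(** The trapezoidal rule in x is exact because the x-derivative is affine; it is applied at heights
    [c] and [d], and the mean of an affine function over [[c, d]] is half the sum of its end
    values. *)
Lemma P2_VEdge_relation p x x' c d : is_P2 p -> c < d ->
  (mean_dn (VEdge x c d) p + mean_dn (VEdge x' c d) p) * (x' - x) =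
  p (x', c) - p (x, c) + (p (x', d) - p (x, d)).
Proof.
move=> pP cd; rewrite !mean_dn_VEdge //.
have [a [b [g [k [e [h ->]]]]]] := is_P2_quad pP.
by rewrite /quad /=; field.
Qed.

Lemma P2_HEdge_relation p y y' c d : is_P2 p -> c < d ->
  (mean_dn (HEdge y c d) p + mean_dn (HEdge y' c d) p) * (y' - y) =
  p (c, y') - p (c, y) + (p (d, y') - p (d, y)).
Proof.
move=> pP cd; rewrite !mean_dn_HEdge //.
have [a [b [g [k [e [h ->]]]]]] := is_P2_quad pP.
by rewrite /quad /=; field.
Qed.

(** The mixed second difference of the corner values isolates the coefficient of xy, differences of
    opposite edge means isolate the two square coefficients, and the remainder is affine. *)
Lemma P2_unisolvent p x x' y y' : is_P2 p -> x < x' -> y < y' ->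
  p (x, y) = 0 -> p (x', y) = 0 -> p (x, y') = 0 -> p (x', y') = 0 ->
  mean_dn (VEdge x y y') p = 0 -> mean_dn (VEdge x' y y') p = 0 ->
  mean_dn (HEdge y x x') p = 0 -> mean_dn (HEdge y' x x') p = 0 ->
  forall z, p z = 0.
Proof.
move=> pP xx yy; rewrite !mean_dn_VEdge // !mean_dn_HEdge //.
have [a [b [g [k [e [h ->]]]]]] := is_P2_quad pP.
rewrite /quad /= => p1 p2 p3 p4 m1 m2 m3 m4.
have x0 : x' - x != 0 by rewrite subr_eq0 gt_eqF.
have y0 : y' - y != 0 by rewrite subr_eq0 gt_eqF.
have e0 : e = 0.
  suff /eqP : e * ((x' - x) * (y' - y)) = 0.
    by rewrite mulf_eq0 mulf_eq0 (negPf x0) (negPf y0) !orbF => /eqP.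
  by lra.
have k0 : k = 0.
  suff /eqP : k * (x' - x) = 0 by rewrite mulf_eq0 (negPf x0) orbF => /eqP.
  by rewrite e0 in m1 m2; lra.
have h0 : h = 0.
  suff /eqP : h * (y' - y) = 0 by rewrite mulf_eq0 (negPf y0) orbF => /eqP.
  by rewrite e0 in m3 m4; lra.
subst e k h.
have b0 : b = 0 by lra.
have g0 : g = 0 by lra.
subst b g.
have a0 : a = 0 by lra.
by move=> z; rewrite a0; ring.
Qed.

End Quadratics.

(** * Rectangular grids *)

Section Rectangles.
Variable R : realType.
Implicit Types (Q : rect R) (z : R * R) (A D : set (R * R)).

Definition open_rect Q : set (R * R) := `]xl Q, xr Q[ `*` `]yb Q, yt Q[.

Lemma rect_setE Q z : rect_set Q z =
  ((xl Q <= z.1 <= xr Q) /\ (yb Q <= z.2 <= yt Q)).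
Proof. by rewrite /rect_set /setX /= !in_itv. Qed.

Lemma open_rectE Q z : open_rect Q z =
  ((xl Q < z.1 < xr Q) /\ (yb Q < z.2 < yt Q)).
Proof. by rewrite /open_rect /setX /= !in_itv. Qed.

Lemma open_rect_sub Q : open_rect Q `<=` rect_set Q.
Proof.
move=> z; rewrite open_rectE rect_setE => -[/andP[a b] /andP[c d]].
by split; apply/andP; split; apply: ltW.
Qed.

Lemma open_open_rect Q : open (open_rect Q).
Proof.
have -> : open_rect Q = (fst @^-1` `]xl Q, xr Q[) `&` (snd @^-1` `]yb Q, yt Q[).
  by [].
by apply: openI; apply: open_comp; try exact: interval_open;
  move=> z _; [exact: cvg_fst | exact: cvg_snd].
Qed.

Lemma closed_rect_set Q : closed (rect_set Q).
Proof.
have -> : rect_set Q = (fst @^-1` `[xl Q, xr Q]) `&` (snd @^-1` `[yb Q, yt Q]).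
  by [].
by apply: closedI; apply: preimage_closed; try exact: itv_closed;
  move=> z _; [exact: cvg_fst | exact: cvg_snd].
Qed.

Lemma open_rect_interior Q : open_rect Q `<=` (rect_set Q)°.
Proof.
by rewrite -open_subsetE; [exact: open_rect_sub|exact: open_open_rect].
Qed.

Definition rect_center Q : R * R := ((xl Q + xr Q) / 2, (yb Q + yt Q) / 2).

Lemma rect_center_open Q : xl Q < xr Q -> yb Q < yt Q ->
  open_rect Q (rect_center Q).
Proof. by move=> x y; rewrite open_rectE /=; split; lra. Qed.

(** Serves to leave a boundary point of a rectangle along the line through its center, inwards or
    outwards. *)
Lemma nbhs_small_step z v (U : set (R * R)) : nbhs z U ->
  exists2 t : R, 0 < t < 1 & U (z + t *: v).
Proof.
move=> Uz.
have cf : z + t *: v @[t --> 0^'+] --> z.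
  suff : z + t *: v @[t --> 0^'+] --> z + 0 *: v by rewrite scale0r addr0.
  apply: cvgD; first exact: cvg_cst.
  by apply: cvgZr_tmp; apply: cvg_at_right_filter; exact: cvg_id.
have H : \forall t \near 0^'+, 0 < t < 1 /\ U (z + t *: v).
  near=> t; split; last by near: t; exact: cf.
  apply/andP; split; near: t; [exact: nbhs_right_gt|exact: nbhs_right_lt].
by have [t [t01 Ut]] := @filter_ex _ _ _ _ H; exists t.
Unshelve. all: by end_near. Qed.

(** By convexity, a step from z towards the center of Q enters the open rectangle, hence leaves
    D. *)
Lemma disjoint_not_interior Q D z : xl Q < xr Q -> yb Q < yt Q ->
  open_rect Q `&` D = set0 -> rect_set Q z -> ~ D° z.
Proof.
move=> xx yy QD; rewrite rect_setE => -[z1 z2].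
move=> /(nbhs_small_step (rect_center Q - z))[t /andP[t0 t1] Dt].
suff : (open_rect Q `&` D) (z + t *: (rect_center Q - z)) by rewrite QD.
split => //; rewrite open_rectE /=.
set cx := (xl Q + xr Q) / 2; set cy := (yb Q + yt Q) / 2.
rewrite /GRing.scale /=.
have [a1 a2] : xl Q < cx /\ cx < xr Q by rewrite /cx; split; lra.
have [a3 a4] : yb Q < cy /\ cy < yt Q by rewrite /cy; split; lra.
by split; apply/andP; split; nra.
Qed.

Lemma rect_interiorE Q : xl Q < xr Q -> yb Q < yt Q ->
  (rect_set Q)° = open_rect Q.
Proof.
move=> xx yy; apply/seteqP; split; last exact: open_rect_interior.
move=> z Qz; have := interior_subset Qz; rewrite rect_setE open_rectE => -[z1 z2].
(* A step away from the center leaves the rectangle if z is on its boundary. *)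
have [t /andP[t0 t1]] := nbhs_small_step (z - rect_center Q) Qz.
rewrite rect_setE /= /GRing.scale /= => -[w1 w2].
by split; apply/andP; split; nra.
Qed.

Lemma frontier_rectE Q : xl Q < xr Q -> yb Q < yt Q ->
  frontier (rect_set Q) = rect_set Q `\` open_rect Q.
Proof.
move=> xx yy; rewrite /frontier rect_interiorE //.
by have /closure_id <- := closed_rect_set (Q := Q).
Qed.

End Rectangles.

Section Grid.
Variables (R : realType) (T : finType) (cell : T -> rect R).
Variable Omega : set (R * R).
Hypothesis grid : rectangular_grid cell Omega.
Hypothesis regO : (closure Omega)° = Omega.
Implicit Types (K : T) (z : R * R).

Lemma cell_ltx K : xl (cell K) < xr (cell K).
Proof. by case: grid => /(_ K)[]. Qed.

Lemma cell_lty K : yb (cell K) < yt (cell K).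
Proof. by case: grid => /(_ K)[]. Qed.

Lemma open_rect_cell_inj K K' z :
  open_rect (cell K) z -> open_rect (cell K') z -> K = K'.
Proof.
move=> Kz K'z; apply: contrapT => KK'; case: grid => _ _ /(_ _ _ KK') + _.
move=> /seteqP[+ _] => /(_ z); apply; split; exact: open_rect_interior.
Qed.

Lemma cell_separated K K' : K <> K' ->
  [\/ xr (cell K) <= xl (cell K'), xr (cell K') <= xl (cell K),
      yt (cell K) <= yb (cell K') | yt (cell K') <= yb (cell K)].
Proof.
move=> KK'.
have [?|x1] := leP (xr (cell K)) (xl (cell K')); first by constructor 1.
have [?|x2] := leP (xr (cell K')) (xl (cell K)); first by constructor 2.
have [?|y1] := leP (yt (cell K)) (yb (cell K')); first by constructor 3.
have [?|y2] := leP (yt (cell K')) (yb (cell K)); first by constructor 4.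
have := (cell_ltx K, cell_ltx K', cell_lty K, cell_lty K') => -[[[a b] c] d].
case: KK'.
(* If no separation holds, both projections overlap in open intervals, whose midpoints give a common
   interior point. *)
have mid (u v u' v' : R) : u < v -> u' < v' -> u < v' -> u' < v ->
    exists t, [/\ u < t, t < v, u' < t & t < v'].
  move=> h1 h2 h3 h4; exists ((Num.max u u' + Num.min v v') / 2).
  have : Num.max u u' < Num.min v v'.
    by rewrite gt_max !lt_min; apply/andP; split; apply/andP; split.
  have [] := leP u u'; have [] := leP v v' => *; split; lra.
have [x [hx1 hx2 hx3 hx4]] := mid _ _ _ _ a b x2 x1.
have [y [hy1 hy2 hy3 hy4]] := mid _ _ _ _ c d y2 y1.
apply: (@open_rect_cell_inj _ _ (x, y)); rewrite open_rectE /=; split;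
  by apply/andP; split.
Qed.

(** Cells with the same lower left corner overlap near it, whatever their sizes. *)
Lemma cell_eqP K K' : xl (cell K) = xl (cell K') ->
  yb (cell K) = yb (cell K') -> K = K'.
Proof.
move=> xx yy; apply: contrapT => /cell_separated.
have := (cell_ltx K, cell_ltx K', cell_lty K, cell_lty K') => -[[[a b] c] d].
by case; lra.
Qed.

(* A horizontal overlap of two touching cells forces one to lie above the
   other; without hanging nodes they are then aligned. *)
Lemma touching_columns K K' z : rect_set (cell K) z -> rect_set (cell K') z ->
  [\/ xl (cell K) = xl (cell K') /\ xr (cell K) = xr (cell K'),
      xr (cell K) = xl (cell K') | xr (cell K') = xl (cell K)].
Proof.
have [->|/eqP KK'] := eqVneq K K'; first by constructor 1.
move=> Kz K'z.
have := (Kz, K'z); rewrite !rect_setE => -[[kx ky] [kx' ky']].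
have := (cell_ltx K, cell_ltx K', cell_lty K, cell_lty K') => -[[[a b] c] d].
have [x1|x1] := leP (xr (cell K)) (xl (cell K')); first by constructor 2; lra.
have [x2|x2] := leP (xr (cell K')) (xl (cell K)); first by constructor 3; lra.
constructor 1.
case: grid => _ _ _ nohang.
have vert H H' x y : rect_set (cell H') (x, y) -> is_vertex (cell H) (x, y) ->
    x = xl (cell H') \/ x = xr (cell H').
  by move=> h1 h2; case: (nohang _ _ _ h2 h1).
(* An end of the horizontal side of H at the height of z that falls within the side of H' is a
   vertex of H', so it cannot be strictly inside that side. *)
have corner H H' y : rect_set (cell H) z -> rect_set (cell H') z ->
    y = z.2 -> y = yb (cell H) \/ y = yt (cell H) ->
    xl (cell H) < xr (cell H') -> xl (cell H') < xr (cell H) ->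
    (xl (cell H') <= xl (cell H) -> xl (cell H) = xl (cell H')) /\
    (xr (cell H) <= xr (cell H') -> xr (cell H) = xr (cell H')).
  move=> Hz H'z yz yv h1 h2.
  have := cell_ltx H; have := cell_ltx H' => l1 l2.
  have := (Hz, H'z); rewrite !rect_setE => -[[hx hy] [hx' hy']].
  split => h3.
    have : rect_set (cell H') (xl (cell H), y).
      by rewrite rect_setE /= yz; split => //; lra.
    move=> /(vert H) hv; case: hv; [split => //=; by left|by []|lra].
  have : rect_set (cell H') (xr (cell H), y).
    by rewrite rect_setE /= yz; split => //; lra.
  move=> /(vert H) hv; case: hv; [split => //=; by right|lra|by []].
(* Since the column ranges overlap, the separation is vertical, and z lies on horizontal sides of
   both cells. *)
have yy : yt (cell K) = yb (cell K') /\ yt (cell K) = z.2 \/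
          yt (cell K') = yb (cell K) /\ yt (cell K') = z.2.
  by case: (cell_separated KK'); lra.
have [y1 [y2 [e1 e2 e3 e4]]] : exists y1 y2,
   [/\ y1 = z.2, y2 = z.2, y1 = yb (cell K) \/ y1 = yt (cell K) &
       y2 = yb (cell K') \/ y2 = yt (cell K')].
  case: yy => -[h1 h2].
    by exists (yt (cell K)), (yb (cell K')); split; auto; lra.
  by exists (yb (cell K)), (yt (cell K')); split; auto; lra.
have [c1 c2] := corner K K' y1 Kz K'z e1 e3 x2 x1.
have [c3 c4] := corner K' K y2 K'z Kz e2 e4 x1 x2.
split.
  by have [/c1|/ltW/c3 ->] := leP (xl (cell K')) (xl (cell K)).
by have [/c2|/ltW/c4 ->] := leP (xr (cell K)) (xr (cell K')).
Qed.

Lemma touching_rows K K' z : rect_set (cell K) z -> rect_set (cell K') z ->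
  [\/ yb (cell K) = yb (cell K') /\ yt (cell K) = yt (cell K'),
      yt (cell K) = yb (cell K') | yt (cell K') = yb (cell K)].
Proof.
have [->|/eqP KK'] := eqVneq K K'; first by constructor 1.
move=> Kz K'z.
have := (Kz, K'z); rewrite !rect_setE => -[[kx ky] [kx' ky']].
have := (cell_ltx K, cell_ltx K', cell_lty K, cell_lty K') => -[[[a b] c] d].
have [x1|x1] := leP (yt (cell K)) (yb (cell K')); first by constructor 2; lra.
have [x2|x2] := leP (yt (cell K')) (yb (cell K)); first by constructor 3; lra.
constructor 1.
case: grid => _ _ _ nohang.
have vert H H' x y : rect_set (cell H') (x, y) -> is_vertex (cell H) (x, y) ->
    y = yb (cell H') \/ y = yt (cell H').
  by move=> h1 h2; case: (nohang _ _ _ h2 h1).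
have corner H H' x : rect_set (cell H) z -> rect_set (cell H') z ->
    x = z.1 -> x = xl (cell H) \/ x = xr (cell H) ->
    yb (cell H) < yt (cell H') -> yb (cell H') < yt (cell H) ->
    (yb (cell H') <= yb (cell H) -> yb (cell H) = yb (cell H')) /\
    (yt (cell H) <= yt (cell H') -> yt (cell H) = yt (cell H')).
  move=> Hz H'z yz yv h1 h2.
  have := cell_lty H; have := cell_lty H' => l1 l2.
  have := (Hz, H'z); rewrite !rect_setE => -[[hx hy] [hx' hy']].
  split => h3.
    have : rect_set (cell H') (x, yb (cell H)).
      by rewrite rect_setE /= yz; split => //; lra.
    move=> /(vert H) hv; case: hv; [split => //=; by left|by []|lra].
  have : rect_set (cell H') (x, yt (cell H)).
    by rewrite rect_setE /= yz; split => //; lra.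
  move=> /(vert H) hv; case: hv; [split => //=; by right|lra|by []].
have yy : xr (cell K) = xl (cell K') /\ xr (cell K) = z.1 \/
          xr (cell K') = xl (cell K) /\ xr (cell K') = z.1.
  by case: (cell_separated KK'); lra.
have [y1 [y2 [e1 e2 e3 e4]]] : exists y1 y2,
   [/\ y1 = z.1, y2 = z.1, y1 = xl (cell K) \/ y1 = xr (cell K) &
       y2 = xl (cell K') \/ y2 = xr (cell K')].
  case: yy => -[h1 h2].
    by exists (xr (cell K)), (xl (cell K')); split; auto; lra.
  by exists (xl (cell K)), (xr (cell K')); split; auto; lra.
have [c1 c2] := corner K K' y1 Kz K'z e1 e3 x2 x1.
have [c3 c4] := corner K' K y2 K'z Kz e2 e4 x1 x2.
split.
  by have [/c1|/ltW/c3 ->] := leP (yb (cell K')) (yb (cell K)).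
by have [/c2|/ltW/c4 ->] := leP (yt (cell K)) (yt (cell K')).
Qed.

Lemma cell_sub_closure K : rect_set (cell K) `<=` closure Omega.
Proof. by case: grid => _ -> _ _ z Kz; exists K. Qed.

(** Regularity excludes slits: an open set covered by closed cells lies in Omega even where it
    crosses grid lines. *)
Lemma open_sub_domain A : open A -> A `<=` closure Omega -> A `<=` Omega.
Proof. by move=> oA AO; rewrite -regO -open_subsetE. Qed.

Lemma left_of_inj_r K1 K2 K3 :
  left_of cell K1 K2 -> left_of cell K1 K3 -> K2 = K3.
Proof. by case=> a b _ [c d _]; apply: cell_eqP; lra. Qed.

Lemma below_inj_r K1 K2 K3 : below cell K1 K2 -> below cell K1 K3 -> K2 = K3.
Proof. by case=> a b _ [c d _]; apply: cell_eqP; lra. Qed.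

Lemma left_of_inj_l K1 K2 K3 :
  left_of cell K2 K1 -> left_of cell K3 K1 -> K2 = K3.
Proof.
case=> a b c [d e f]; apply: contrapT => /cell_separated.
have := (cell_ltx K2, cell_ltx K3, cell_lty K2, cell_lty K3) => -[[[h1 h2] h3] h4].
by case; lra.
Qed.

Lemma below_inj_l K1 K2 K3 : below cell K2 K1 -> below cell K3 K1 -> K2 = K3.
Proof.
case=> a b c [d e f]; apply: contrapT => /cell_separated.
have := (cell_ltx K2, cell_ltx K3, cell_lty K2, cell_lty K3) => -[[[h1 h2] h3] h4].
by case; lra.
Qed.

End Grid.

(** * The basis functions as products of B-splines *)

Section SplineData.
Variable R : realType.
Implicit Types (X : nat -> R).

(* Values and slopes at the knots of the quadratic B-spline with knots
   X 0 < X 1 < X 2 < X 3. *)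
Definition bspline X (i : nat) : R :=
  match i with
  | 1%N => (X 1%N - X 0%N) / (X 2%N - X 0%N)
  | 2%N => (X 3%N - X 2%N) / (X 3%N - X 1%N)
  | _ => 0
  end.

Definition dbspline X (i : nat) : R :=
  match i with
  | 1%N => 2 / (X 2%N - X 0%N)
  | 2%N => - 2 / (X 3%N - X 1%N)
  | _ => 0
  end.

(* Along a row of cells, u i stands for the sum of the two vertex values on the
   i-th grid line and m i for the edge mean between them, hence the factor 1/2. *)
Lemma spline_recurrence (X u m : nat -> R) :
  (forall i, (i < 3)%N -> X i < X i.+1) ->
  (forall i, (i < 3)%N -> (m i + m i.+1) * (X i.+1 - X i) = u i.+1 - u i) ->
  u 0%N = 0 -> u 3%N = 0 -> m 0%N = 0 -> m 3%N = 0 ->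
  forall w, u 1%N = w * bspline X 1 ->
  forall i, (i < 4)%N -> u i = w * bspline X i /\ m i = w * (dbspline X i / 2).
Proof.
move=> Xlt rel u0 u3 m0 m3 w uw.
have [X0 X1 X2] : [/\ X 0%N < X 1%N, X 1%N < X 2%N & X 2%N < X 3%N].
  by split; apply: Xlt.
(* Three equations for [u 1], [u 2], [m 1], [m 2]: the solutions form a line, on which [u 1] fixes
   the point. *)
have [r0 r1 r2] := And3 (rel 0%N isT) (rel 1%N isT) (rel 2%N isT).
rewrite u0 u3 m0 m3 in r0 r1 r2.
have d02 : X 2%N - X 0%N != 0 by apply/eqP; lra.
have d13 : X 3%N - X 1%N != 0 by apply/eqP; lra.
have d01 : X 1%N - X 0%N != 0 by apply/eqP; lra.
have d12 : X 2%N - X 1%N != 0 by apply/eqP; lra.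
have d23 : X 3%N - X 2%N != 0 by apply/eqP; lra.
have m1 : m 1%N = w / (X 2%N - X 0%N).
  apply: (mulIf d01); rewrite -[m 1%N]add0r r0 uw /bspline; field.
  by rewrite d02.
have m2 : m 2%N * (X 3%N - X 2%N) = - u 2%N by lra.
have u2 : u 2%N = w * bspline X 2.
  have e : u 2%N - u 1%N =
      (w / (X 2%N - X 0%N) - u 2%N / (X 3%N - X 2%N)) * (X 2%N - X 1%N).
    rewrite -r1 m1; congr (_ * _); congr (_ + _).
    by apply: (mulIf d23); rewrite m2; field.
  apply: (mulIf d13); rewrite /bspline.
  have : u 2%N * (X 3%N - X 1%N) = w * (X 3%N - X 2%N).
    have -> : w * (X 3%N - X 2%N) =
        (X 3%N - X 2%N) * (u 1%N + w / (X 2%N - X 0%N) * (X 2%N - X 1%N)).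
      by rewrite uw /bspline; field; rewrite d02.
    have -> : u 1%N + w / (X 2%N - X 0%N) * (X 2%N - X 1%N) =
        u 2%N + u 2%N / (X 3%N - X 2%N) * (X 2%N - X 1%N).
      by move: e; lra.
    by field.
  by move=> ->; field.
have m2' : m 2%N = w * (- 1 / (X 3%N - X 1%N)).
  by apply: (mulIf d23); rewrite m2 u2 /bspline; field.
case=> [|[|[|[|//]]]] _.
- by rewrite u0 m0 /=; split; field.
- by rewrite uw m1 /=; split => //; field; rewrite d02.
- by rewrite u2 m2' /=; split => //; field; rewrite d13.
- by rewrite u3 m3 /=; split; field.
Qed.

End SplineData.

(** * The Morley space of a 3 x 3 patch *)

Section Patch.
Variables (R : realType) (T : finType) (cell : T -> rect R).
Hypothesis cellx : forall K, xl (cell K) < xr (cell K).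
Hypothesis celly : forall K, yb (cell K) < yt (cell K).
Variables (K : T) (M : nat -> nat -> T).
Hypothesis patchM : is_patch cell K M.

(** Read off the bottom row ([knoty]: the left column); by [patch_cellE] the other rows and columns
    have the same lines. *)
Definition knotx (i : nat) : R :=
  if (i < 3)%N then xl (cell (M i 0%N)) else xr (cell (M 2%N 0%N)).
Definition knoty (j : nat) : R :=
  if (j < 3)%N then yb (cell (M 0%N j)) else yt (cell (M 0%N 2%N)).

Lemma patch_cellE i j : (i < 3)%N -> (j < 3)%N ->
  [/\ xl (cell (M i j)) = knotx i, xr (cell (M i j)) = knotx i.+1,
      yb (cell (M i j)) = knoty j & yt (cell (M i j)) = knoty j.+1].
Proof.
move=> i3 j3; have [_ L B] := patchM.
have cx k l : (k < 3)%N -> (l < 3)%N -> xl (cell (M k l)) = xl (cell (M k 0%N)) /\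
    xr (cell (M k l)) = xr (cell (M k 0%N)).
  move=> k3; elim: l => // l IH l3; have [//|<- <-] := IH; first exact: ltnW.
  by have [_ -> ->] := B k l k3 l3.
have cy k l : (k < 3)%N -> (l < 3)%N -> yb (cell (M l k)) = yb (cell (M 0%N k)) /\
    yt (cell (M l k)) = yt (cell (M 0%N k)).
  move=> k3; elim: l => // l IH l3; have [//|<- <-] := IH; first exact: ltnW.
  by have [_ -> ->] := L l k l3 k3.
have [-> ->] := cx i j i3 j3; have [-> ->] := cy j i j3 i3.
rewrite /knotx /knoty i3 j3; split => //.
  have [i2|i2] := ltnP i 2; last by have -> : i = 2%N by lia.
  by rewrite ltnS i2; case: (L i 0%N i2 isT).
have [j2|j2] := ltnP j 2; last by have -> : j = 2%N by lia.
by rewrite ltnS j2; case: (B 0%N j isT j2).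
Qed.

Lemma knotx_lt i : (i < 3)%N -> knotx i < knotx i.+1.
Proof. by move=> i3; have [<- <- _ _] := patch_cellE i3 i3. Qed.

Lemma knoty_lt i : (i < 3)%N -> knoty i < knoty i.+1.
Proof. by move=> i3; have [_ _ <- <-] := patch_cellE i3 i3. Qed.

Definition patch_rect : rect R :=
  Rect (knotx 0) (knotx 3) (knoty 0) (knoty 3).

Lemma patch_domainE : patch_domain cell M = rect_set patch_rect.
Proof.
have x01 := knotx_lt (isT : 0 < 3)%N; have x12 := knotx_lt (isT : 1 < 3)%N.
have x23 := knotx_lt (isT : 2 < 3)%N; have y01 := knoty_lt (isT : 0 < 3)%N.
have y12 := knoty_lt (isT : 1 < 3)%N; have y23 := knoty_lt (isT : 2 < 3)%N.
apply/seteqP; split => z.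
  move=> [_ [i [j [i3 j3 ->]]]]; rewrite !rect_setE /=.
  have [-> -> -> ->] := patch_cellE i3 j3.
  by case: i i3 => [|[|[|//]]] _; case: j j3 => [|[|[|//]]] _ [h1 h2];
    split; lra.
rewrite rect_setE /= => -[h1 h2].
have [i i3 xi] : exists2 i, (i < 3)%N & knotx i <= z.1 <= knotx i.+1.
  have [?|?] := leP z.1 (knotx 1); first by exists 0%N => //; lra.
  have [?|?] := leP z.1 (knotx 2); first by exists 1%N => //; lra.
  by exists 2%N => //; lra.
have [j j3 yj] : exists2 i, (i < 3)%N & knoty i <= z.2 <= knoty i.+1.
  have [?|?] := leP z.2 (knoty 1); first by exists 0%N => //; lra.
  have [?|?] := leP z.2 (knoty 2); first by exists 1%N => //; lra.
  by exists 2%N => //; lra.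
exists (M i j); first by exists i, j.
by rewrite rect_setE; have [-> -> -> ->] := patch_cellE i3 j3.
Qed.

Lemma patch_frontierE : frontier (patch_domain cell M) =
  rect_set patch_rect `\` open_rect patch_rect.
Proof.
have x01 := knotx_lt (isT : 0 < 3)%N; have x12 := knotx_lt (isT : 1 < 3)%N.
have x23 := knotx_lt (isT : 2 < 3)%N; have y01 := knoty_lt (isT : 0 < 3)%N.
have y12 := knoty_lt (isT : 1 < 3)%N; have y23 := knoty_lt (isT : 2 < 3)%N.
by rewrite patch_domainE frontier_rectE //=; lra.
Qed.

Lemma knotx_homo i j : (i <= j)%N -> (j < 4)%N -> knotx i <= knotx j.
Proof.
move=> ij; elim: j ij => [|j IH]; first by rewrite leqn0 => /eqP ->.
rewrite leq_eqVlt => /orP[/eqP->//|]; rewrite ltnS => /IH{}IH j3.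
by apply: (le_trans (IH _)); [exact: ltnW | exact/ltW/knotx_lt].
Qed.

Lemma knoty_homo i j : (i <= j)%N -> (j < 4)%N -> knoty i <= knoty j.
Proof.
move=> ij; elim: j ij => [|j IH]; first by rewrite leqn0 => /eqP ->.
rewrite leq_eqVlt => /orP[/eqP->//|]; rewrite ltnS => /IH{}IH j3.
by apply: (le_trans (IH _)); [exact: ltnW | exact/ltW/knoty_lt].
Qed.

Definition boundary_knot (i : nat) := (i == 0%N) || (i == 3%N).

Lemma knotx_strict i : (i < 4)%N -> ~~ boundary_knot i ->
  knotx 0 < knotx i < knotx 3.
Proof.
case: i => [|[|[|[|//]]]] // _ _.
  by rewrite knotx_lt //=; apply: (lt_trans (knotx_lt _) (knotx_lt _)).
by rewrite knotx_lt //= andbT; apply: (lt_trans (knotx_lt _) (knotx_lt _)).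
Qed.

Lemma knoty_strict i : (i < 4)%N -> ~~ boundary_knot i ->
  knoty 0 < knoty i < knoty 3.
Proof.
case: i => [|[|[|[|//]]]] // _ _.
  by rewrite knoty_lt //=; apply: (lt_trans (knoty_lt _) (knoty_lt _)).
by rewrite knoty_lt //= andbT; apply: (lt_trans (knoty_lt _) (knoty_lt _)).
Qed.

Lemma frontier_knotx i y : boundary_knot i -> knoty 0 <= y <= knoty 3 ->
  frontier (patch_domain cell M) (knotx i, y).
Proof.
move=> bi yy; rewrite patch_frontierE /setD /=.
have h := knotx_homo (isT : 0 <= 3)%N isT.
rewrite rect_setE open_rectE /=; split.
  by split => //; case/orP: bi => /eqP ->; rewrite lexx ?andbT.
by case/orP: bi => /eqP ->; rewrite ltxx ?andbF => -[].
Qed.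

Lemma frontier_knoty j x : boundary_knot j -> knotx 0 <= x <= knotx 3 ->
  frontier (patch_domain cell M) (x, knoty j).
Proof.
move=> bi yy; rewrite patch_frontierE /setD /=.
have h := knoty_homo (isT : 0 <= 3)%N isT.
rewrite rect_setE open_rectE /=; split.
  by split => //; case/orP: bi => /eqP ->; rewrite lexx ?andbT.
by case/orP: bi => /eqP ->; rewrite ltxx ?andbF => -[].
Qed.

Lemma not_frontier_knots x y : knotx 0 < x < knotx 3 -> knoty 0 < y < knoty 3 ->
  ~ frontier (patch_domain cell M) (x, y).
Proof.
move=> hx hy; rewrite patch_frontierE => -[_]; apply.
by rewrite open_rectE.
Qed.

Variables (phi : R * R -> R) (p : T -> R * R -> R).
Hypothesis piecesM : RRM_pieces cell (patch_domain cell M) (patch_cells M) phi p.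

Lemma patch_P2 i j : (i < 3)%N -> (j < 3)%N -> is_P2 (p (M i j)).
Proof.
by move=> i3 j3; case: piecesM => _ /(_ (M i j)) []//; exists i, j.
Qed.

(** Knot 3 is the far end of cell 2, hence [minn]. This cell is just one of those meeting at the
    vertex; [patch_vertex] shows that the choice does not matter. *)
Definition vertex_value i j :=
  p (M (minn i 2) (minn j 2)) (knotx i, knoty j).
Definition vedge_mean i j :=
  mean_dn (VEdge (knotx i) (knoty j) (knoty j.+1)) (p (M (minn i 2) j)).
Definition hedge_mean i j :=
  mean_dn (HEdge (knoty j) (knotx i) (knotx i.+1)) (p (M i (minn j 2))).

(** The offsets [a], [b] pick a corner of the cell. Values agree by continuity at inner vertices,
    and because all of them vanish at boundary vertices. *)
Lemma patch_vertex a b i j : (i < 3)%N -> (j < 3)%N -> (a < 2)%N -> (b < 2)%N ->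
  p (M i j) (knotx (i + a), knoty (j + b)) = vertex_value (i + a) (j + b) /\
  (boundary_knot (i + a) || boundary_knot (j + b) -> vertex_value (i + a) (j + b) = 0).
Proof.
have vtx : forall i j a b, (i < 3)%N -> (j < 3)%N -> (a < 2)%N -> (b < 2)%N ->
    is_vertex (cell (M i j)) (knotx (i + a), knoty (j + b)).
  move=> {}i {}j {}a {}b i3 j3 a2 b2; rewrite /is_vertex /=.
  have [-> -> -> ->] := patch_cellE i3 j3.
  by case: a a2 => [|[|//]] _; case: b b2 => [|[|//]] _; rewrite ?addn0 ?addn1; auto.
move=> i3 j3 a2 b2.
set i' := (i + a)%N; set j' := (j + b)%N.
have vtx' : is_vertex (cell (M (minn i' 2) (minn j' 2))) (knotx i', knoty j').
  have := @vtx (minn i' 2) (minn j' 2) (i' - minn i' 2)%N (j' - minn j' 2)%N.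
  by rewrite !subnKC ?geq_minl //; apply; rewrite /i' /j'; lia.
have [i4 j4] : (i' < 4)%N /\ (j' < 4)%N by rewrite /i' /j'; split; lia.
case: piecesM => _ _ cont _ [bd _].
have g1 : patch_cells M (M i j) by exists i, j.
have g2 : patch_cells M (M (minn i' 2) (minn j' 2)).
  by exists (minn i' 2), (minn j' 2); split => //; lia.
case: (boolP (boundary_knot i' || boundary_knot j')) => [bij|].
  have fr : frontier (patch_domain cell M) (knotx i', knoty j').
    case/orP: bij => bb; [apply: frontier_knotx | apply: frontier_knoty] => //;
    by rewrite ?knotx_homo ?knoty_homo.
  have v0 := bd _ fr.
  by rewrite v0 ?/vertex_value ?v0 //; [exact: vtx].
rewrite negb_or => /andP[bi bj]; split => //.
apply: cont => //; last exact: vtx.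
by apply: not_frontier_knots; [exact: knotx_strict | exact: knoty_strict].
Qed.

Lemma patch_VEdge a i j : (i < 3)%N -> (j < 3)%N -> (a < 2)%N ->
  mean_dn (VEdge (knotx (i + a)) (knoty j) (knoty j.+1)) (p (M i j)) =
    vedge_mean (i + a) j /\ (boundary_knot (i + a) -> vedge_mean (i + a) j = 0).
Proof.
have vtx : forall i j a, (i < 3)%N -> (j < 3)%N -> (a < 2)%N ->
    is_edge (cell (M i j)) (VEdge (knotx (i + a)) (knoty j) (knoty j.+1)).
  move=> {}i {}j {}a i3 j3 a2; rewrite /is_edge.
  have [-> -> -> ->] := patch_cellE i3 j3.
  case: a a2 => [|[|//]] _; rewrite ?addn0 ?addn1; first by constructor 1.
  by constructor 2.
move=> i3 j3 a2.
set i' := (i + a)%N.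
have vtx' : is_edge (cell (M (minn i' 2) j)) (VEdge (knotx i') (knoty j) (knoty j.+1)).
  have := @vtx (minn i' 2) j (i' - minn i' 2)%N.
  by rewrite !subnKC ?geq_minl //; apply; rewrite /i'; lia.
have i4 : (i' < 4)%N by rewrite /i'; lia.
case: piecesM => _ _ _ cont [_ bd].
have g1 : patch_cells M (M i j) by exists i, j.
have g2 : patch_cells M (M (minn i' 2) j).
  by exists (minn i' 2), j; split => //; lia.
have y03 : knoty 0 <= knoty j /\ knoty j.+1 <= knoty 3.
  by split; apply: knoty_homo => //; lia.
have yj := knoty_lt j3.
case: (boolP (boundary_knot i')) => [bij|bi].
  have fr : edge_set (VEdge (knotx i') (knoty j) (knoty j.+1)) `<=`
      frontier (patch_domain cell M).
    move=> [x y] [/= -> ]; rewrite in_itv /= => yy.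
    by apply: frontier_knotx => //; lra.
  have v0 := bd _ fr.
  by rewrite /vedge_mean (v0 _ g1 (vtx _ _ _ i3 j3 a2)) (v0 _ g2 vtx').
split; last by move=> b; case/negP: bi.
apply: (cont _ _ _ _ g1 g2 (vtx _ _ _ i3 j3 a2) vtx').
(* The midpoint witnesses that an inner edge is not contained in the frontier; its ends may lie
   there. *)
move=> /(_ (knotx i', (knoty j + knoty j.+1) / 2)) /=.
have : edge_set (VEdge (knotx i') (knoty j) (knoty j.+1))
         (knotx i', (knoty j + knoty j.+1) / 2).
  by split => //=; rewrite in_itv /=; lra.
move=> h /(_ h); apply: not_frontier_knots; first exact: knotx_strict.
lra.
Qed.

Lemma patch_HEdge a i j : (i < 3)%N -> (j < 3)%N -> (a < 2)%N ->
  mean_dn (HEdge (knoty (j + a)) (knotx i) (knotx i.+1)) (p (M i j)) =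
    hedge_mean i (j + a) /\ (boundary_knot (j + a) -> hedge_mean i (j + a) = 0).
Proof.
have vtx : forall i j a, (i < 3)%N -> (j < 3)%N -> (a < 2)%N ->
    is_edge (cell (M i j)) (HEdge (knoty (j + a)) (knotx i) (knotx i.+1)).
  move=> {}i {}j {}a i3 j3 a2; rewrite /is_edge.
  have [-> -> -> ->] := patch_cellE i3 j3.
  case: a a2 => [|[|//]] _; rewrite ?addn0 ?addn1; first by constructor 3.
  by constructor 4.
move=> i3 j3 a2.
set j' := (j + a)%N.
have vtx' : is_edge (cell (M i (minn j' 2))) (HEdge (knoty j') (knotx i) (knotx i.+1)).
  have := @vtx i (minn j' 2) (j' - minn j' 2)%N.
  by rewrite !subnKC ?geq_minl //; apply; rewrite /j'; lia.
have i4 : (j' < 4)%N by rewrite /j'; lia.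
case: piecesM => _ _ _ cont [_ bd].
have g1 : patch_cells M (M i j) by exists i, j.
have g2 : patch_cells M (M i (minn j' 2)).
  by exists i, (minn j' 2); split => //; lia.
have x03 : knotx 0 <= knotx i /\ knotx i.+1 <= knotx 3.
  by split; apply: knotx_homo => //; lia.
have xi := knotx_lt i3.
case: (boolP (boundary_knot j')) => [bij|bi].
  have fr : edge_set (HEdge (knoty j') (knotx i) (knotx i.+1)) `<=`
      frontier (patch_domain cell M).
    move=> [x y] [/= + -> ]; rewrite in_itv /= => xx.
    by apply: frontier_knoty => //; lra.
  have v0 := bd _ fr.
  by rewrite /hedge_mean (v0 _ g1 (vtx _ _ _ i3 j3 a2)) (v0 _ g2 vtx').
split; last by move=> b; case/negP: bi.
apply: (cont _ _ _ _ g1 g2 (vtx _ _ _ i3 j3 a2) vtx').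
move=> /(_ ((knotx i + knotx i.+1) / 2, knoty j')) /=.
have : edge_set (HEdge (knoty j') (knotx i) (knotx i.+1))
         ((knotx i + knotx i.+1) / 2, knoty j').
  by split => //=; rewrite in_itv /=; lra.
move=> h /(_ h); apply: not_frontier_knots; last exact: knoty_strict.
lra.
Qed.

Lemma patch_row_relation i j : (i < 3)%N -> (j < 3)%N ->
  (vedge_mean i j + vedge_mean i.+1 j) * (knotx i.+1 - knotx i) =
  vertex_value i.+1 j + vertex_value i.+1 j.+1 - (vertex_value i j + vertex_value i j.+1).
Proof.
move=> i3 j3.
have yj := knoty_lt j3.
have := @P2_VEdge_relation _ (p (M i j)) (knotx i) (knotx i.+1) _ _ (patch_P2 i3 j3) yj.
have [] := @patch_VEdge 0 i j i3 j3 isT; rewrite addn0 => -> _.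
have [] := @patch_VEdge 1 i j i3 j3 isT; rewrite addn1 => -> _ ->.
have [] := @patch_vertex 0 0 i j i3 j3 isT isT; rewrite !addn0 => -> _.
have [] := @patch_vertex 1 0 i j i3 j3 isT isT; rewrite addn0 addn1 => -> _.
have [] := @patch_vertex 0 1 i j i3 j3 isT isT; rewrite addn0 addn1 => -> _.
have [] := @patch_vertex 1 1 i j i3 j3 isT isT; rewrite !addn1 => -> _.
by ring.
Qed.

Lemma patch_column_relation i j : (i < 3)%N -> (j < 3)%N ->
  (hedge_mean i j + hedge_mean i j.+1) * (knoty j.+1 - knoty j) =
  vertex_value i j.+1 + vertex_value i.+1 j.+1 - (vertex_value i j + vertex_value i.+1 j).
Proof.
move=> i3 j3.
have xi := knotx_lt i3.
have := @P2_HEdge_relation _ (p (M i j)) (knoty j) (knoty j.+1) _ _ (patch_P2 i3 j3) xi.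
have [] := @patch_HEdge 0 i j i3 j3 isT; rewrite addn0 => -> _.
have [] := @patch_HEdge 1 i j i3 j3 isT; rewrite addn1 => -> _ ->.
have [] := @patch_vertex 0 0 i j i3 j3 isT isT; rewrite !addn0 => -> _.
have [] := @patch_vertex 1 0 i j i3 j3 isT isT; rewrite addn0 addn1 => -> _.
have [] := @patch_vertex 0 1 i j i3 j3 isT isT; rewrite addn0 addn1 => -> _.
have [] := @patch_vertex 1 1 i j i3 j3 isT isT; rewrite !addn1 => -> _.
by ring.
Qed.

Hypothesis phiK : p K (xl (cell K), yb (cell K)) =
  rlen (cell (M 0%N 1%N)) / (rlen (cell (M 0%N 1%N)) + rlen (cell K)) *
  (rheight (cell (M 1%N 0%N)) /
    (rheight (cell (M 1%N 0%N)) + rheight (cell K))).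

Let X := knotx.
Let Y := knoty.

Lemma vertex_value0 i j : (i < 4)%N -> (j < 4)%N ->
  boundary_knot i || boundary_knot j -> vertex_value i j = 0.
Proof.
move=> i4 j4 bij.
have := @patch_vertex (i - minn i 2) (j - minn j 2) (minn i 2) (minn j 2).
rewrite !subnKC ?geq_minl // => h; apply: (h _ _ _ _).2 => //; lia.
Qed.

(** The normalization of the basis function is exactly that of the B-splines: the quotients of cell
    widths and heights are their values at knot 1. *)
Lemma vertex_value11 : vertex_value 1 1 = bspline X 1 * bspline Y 1.
Proof.
have [MK _ _] := patchM.
have [x1 x2 y1 y2] := patch_cellE (isT : 1 < 3)%N (isT : 1 < 3)%N.
have [x3 x4 y3 y4] := patch_cellE (isT : 0 < 3)%N (isT : 1 < 3)%N.
have [x5 x6 y5 y6] := patch_cellE (isT : 1 < 3)%N (isT : 0 < 3)%N.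
move: phiK; rewrite -MK /rlen /rheight x1 x2 y1 y2 x3 x4 y5 y6.
rewrite /vertex_value /bspline -/X -/Y => ->.
by congr (_ / _ * (_ / _)); ring.
Qed.

Lemma bsplinex1_neq0 : bspline X 1 != 0.
Proof.
have := knotx_lt (isT : 0 < 3)%N; have := knotx_lt (isT : 1 < 3)%N => h1 h2.
by rewrite /bspline mulf_neq0 ?invr_neq0 //; apply/eqP; rewrite /X; lra.
Qed.

Lemma bspliney1_neq0 : bspline Y 1 != 0.
Proof.
have := knoty_lt (isT : 0 < 3)%N; have := knoty_lt (isT : 1 < 3)%N => h1 h2.
by rewrite /bspline mulf_neq0 ?invr_neq0 //; apply/eqP; rewrite /Y; lra.
Qed.

Lemma vedge_mean0 i j : (i < 4)%N -> (j < 3)%N -> boundary_knot i ->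
  vedge_mean i j = 0.
Proof.
move=> i4 j3 bi; have := @patch_VEdge (i - minn i 2) (minn i 2) j.
rewrite !subnKC ?geq_minl // => h; apply: (h _ _ _).2 => //; lia.
Qed.

Lemma hedge_mean0 i j : (i < 3)%N -> (j < 4)%N -> boundary_knot j ->
  hedge_mean i j = 0.
Proof.
move=> i4 j3 bi; have := @patch_HEdge (j - minn j 2) i (minn j 2).
rewrite !subnKC ?geq_minl // => h; apply: (h _ _ _).2 => //; lia.
Qed.

(** Adding the two end values of every vertical side turns a row of three cells into the
    one-dimensional recurrence. *)
Lemma patch_row_solution j w : (j < 3)%N ->
  vertex_value 1 j + vertex_value 1 j.+1 = w * bspline X 1 ->
  forall i, (i < 4)%N ->
    vertex_value i j + vertex_value i j.+1 = w * bspline X i /\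
    vedge_mean i j = w * (dbspline X i / 2).
Proof.
move=> j3 w1; apply: (@spline_recurrence _ X (fun i => vertex_value i j + vertex_value i j.+1)
  (fun i => vedge_mean i j)) => //; first exact: knotx_lt.
- by move=> i i3; rewrite patch_row_relation //; ring.
- by rewrite !vertex_value0 ?addr0 // ltnW.
- by rewrite !vertex_value0 ?addr0 // ltnW.
- exact: vedge_mean0.
- exact: vedge_mean0.
Qed.

Lemma patch_column_solution i w : (i < 3)%N ->
  vertex_value i 1 + vertex_value i.+1 1 = w * bspline Y 1 ->
  forall j, (j < 4)%N ->
    vertex_value i j + vertex_value i.+1 j = w * bspline Y j /\
    hedge_mean i j = w * (dbspline Y j / 2).
Proof.
move=> j3 w1; apply: (@spline_recurrence _ Y (fun j => vertex_value i j + vertex_value i.+1 j)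
  (fun j => hedge_mean i j)) => //; first exact: knoty_lt.
- by move=> j' i3; rewrite patch_column_relation //; ring.
- by rewrite !vertex_value0 ?orbT ?addr0 // ltnW.
- by rewrite !vertex_value0 ?orbT ?addr0 // ltnW.
- exact: hedge_mean0.
- exact: hedge_mean0.
Qed.

(** A row or column along the border has zeros on its outer line, so its sums are single vertex
    values: the bottom row spreads the value at (1, 1) along height 1, then the left and right
    columns spread it upwards. *)
Lemma vertex_valueE i j : (i < 4)%N -> (j < 4)%N ->
  vertex_value i j = bspline X i * bspline Y j.
Proof.
move=> i4 j4.
have row0 i' : (i' < 4)%N -> vertex_value i' 1 = bspline X i' * bspline Y 1.
  move=> i'4; have [|+ _] := @patch_row_solution 0 (bspline Y 1) isT _ i' i'4.
    by rewrite vertex_value0 // add0r vertex_value11 mulrC.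
  by rewrite vertex_value0 // ?orbT // add0r mulrC.
case: i i4 => [|[|[|[|//]]]] _.
- by rewrite vertex_value0 //= mul0r.
- have [|+ _] := @patch_column_solution 0 (bspline X 1) isT _ j j4.
    by rewrite vertex_value0 // add0r row0.
  by rewrite vertex_value0 // add0r.
- have [|+ _] := @patch_column_solution 2 (bspline X 2) isT _ j j4.
    by rewrite (@vertex_value0 3) // addr0 row0.
  by rewrite (@vertex_value0 3) // addr0.
- by rewrite vertex_value0 //= mul0r.
Qed.

Lemma vedge_meanE i j : (i < 4)%N -> (j < 3)%N -> vedge_mean i j =
  dbspline X i * ((bspline Y j + bspline Y j.+1) / 2).
Proof.
move=> i4 j3.
have [|_ ->] := @patch_row_solution j (bspline Y j + bspline Y j.+1) j3 _ i i4.
  by rewrite !vertex_valueE // 1?ltnW //; ring.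
by field.
Qed.

Lemma hedge_meanE i j : (i < 3)%N -> (j < 4)%N -> hedge_mean i j =
  (bspline X i + bspline X i.+1) / 2 * dbspline Y j.
Proof.
move=> i4 j3.
have [|_ ->] := @patch_column_solution i (bspline X i + bspline X i.+1) i4 _ j j3.
  by rewrite !vertex_valueE // 1?ltnW //; ring.
by field.
Qed.

Lemma basis_vertexE a b i j : (i < 3)%N -> (j < 3)%N -> (a < 2)%N -> (b < 2)%N ->
  p (M i j) (X (i + a), Y (j + b)) = bspline X (i + a) * bspline Y (j + b).
Proof.
move=> i3 j3 a2 b2; have [-> _] := patch_vertex i3 j3 a2 b2.
by rewrite vertex_valueE //; lia.
Qed.

Lemma basis_VEdgeE a i j : (i < 3)%N -> (j < 3)%N -> (a < 2)%N ->
  mean_dn (VEdge (X (i + a)) (Y j) (Y j.+1)) (p (M i j)) =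
  dbspline X (i + a) * ((bspline Y j + bspline Y j.+1) / 2).
Proof.
move=> i3 j3 a2; have [-> _] := patch_VEdge i3 j3 a2.
by rewrite vedge_meanE //; lia.
Qed.

Lemma basis_HEdgeE a i j : (i < 3)%N -> (j < 3)%N -> (a < 2)%N ->
  mean_dn (HEdge (Y (j + a)) (X i) (X i.+1)) (p (M i j)) =
  (bspline X i + bspline X i.+1) / 2 * dbspline Y (j + a).
Proof.
move=> i3 j3 a2; have [-> _] := patch_HEdge i3 j3 a2.
by rewrite hedge_meanE //; lia.
Qed.

End Patch.

(** * Extension by zero and linear independence *)

Section Measure.
Variable R : realType.
Implicit Types (Q : rect R) (z : R * R).

Lemma measurable_rect_set Q :
  measurable (rect_set Q : set (measurableTypeR R * measurableTypeR R)%type).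
Proof. by apply: measurableX; exact: measurable_itv. Qed.

Lemma ae_leb2_filter : Filter (almost_everywhere (leb2 R)).
Proof. exact: ae_filter_ringOfSetsType. Qed.

Lemma leb2_aeS (P P' : R * R -> Prop) : (forall z, P z -> P' z) ->
  (\forall z \ae leb2 R, P z) -> \forall z \ae leb2 R, P' z.
Proof. by move=> PP'; apply: (@filterS _ _ ae_leb2_filter). Qed.

Lemma leb2_aeI (P P' : R * R -> Prop) : (\forall z \ae leb2 R, P z) ->
  (\forall z \ae leb2 R, P' z) -> \forall z \ae leb2 R, P z /\ P' z.
Proof. exact: (@filterI _ _ ae_leb2_filter). Qed.

Lemma leb2_ae_forall (I : finType) (P : I -> R * R -> Prop) :
  (forall i, \forall z \ae leb2 R, P i z) ->
  \forall z \ae leb2 R, forall i, P i z.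
Proof. exact: (@filter_forall _ I P _ ae_leb2_filter). Qed.

Lemma leb2_setX (A B : set (measurableTypeR R)) : measurable A -> measurable B ->
  leb2 R (A `*` B) = (lebesgue_measure A * lebesgue_measure B)%E.
Proof. by move=> mA mB; exact: product_measure1E. Qed.

Lemma negligible_vline (a : R) : (leb2 R).-negligible ([set a] `*` setT).
Proof.
apply/negligibleP; first exact: measurableX.
apply: etrans (leb2_setX _ _) _ => //.
by rewrite lebesgue_measure_set1 mul0e.
Qed.

Lemma negligible_hline (a : R) : (leb2 R).-negligible (setT `*` [set a]).
Proof.
apply/negligibleP; first exact: measurableX.
apply: etrans (leb2_setX _ _) _ => //.
by rewrite lebesgue_measure_set1 mule0.
Qed.

Lemma ae_open_rect Q : \forall z \ae leb2 R, rect_set Q z -> open_rect Q z.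
Proof.
have : (leb2 R).-negligible ((([set xl Q] `*` setT) `|` ([set xr Q] `*` setT)) `|`
   ((setT `*` [set yb Q]) `|` (setT `*` [set yt Q]))).
  apply: negligibleU; apply: negligibleU; by [exact: negligible_vline|exact: negligible_hline].
apply: negligibleS => -[x y] /= /not_implyP[]; rewrite rect_setE open_rectE /=.
move=> [/andP[x1 x2] /andP[y1 y2]] nz.
apply: contrapT => /not_orP[/not_orP[h1 h2] /not_orP[h3 h4]]; apply: nz.
split; apply/andP; split; rewrite lt_neqAle ?x1 ?x2 ?y1 ?y2 andbT; apply/eqP => h.
- by apply: h1; split.
- by apply: h2; split.
- by apply: h3; split.
- by apply: h4; split.
Qed.

Lemma negligible_not_nbhs (A : set (R * R)) z : nbhs z A ->
  (leb2 R).-negligible A -> False.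
Proof.
move=> /nbhs_ballP[e /= e0 zA].
have bE (a : R) : ball a e = `]a - e, a + e[%classic by rewrite ball_itv.
have mb (a : R) : measurable (ball a e) by rewrite bE; exact: measurable_itv.
move=> nA.
have nB : (leb2 R).-negligible (ball z.1 e `*` ball z.2 e).
  by apply: negligibleS nA; apply: subset_trans zA => w [].
have e1 : leb2 R (ball z.1 e `*` ball z.2 e) = 0%E.
  by apply: measure_negligible nB; apply: measurableX; exact: mb.
have := etrans (esym (leb2_setX (mb z.1) (mb z.2))) e1.
rewrite !bE !lebesgue_measure_itv /= !lte_fin.
have h (a : R) : a - e < a + e by lra.
by rewrite !h -!EFinD -EFinM => -[] /eqP; rewrite mulf_eq0 => /orP[] /eqP; lra.
Qed.

Lemma continuous_quad (a b g d e h : R) : continuous (quad a b g d e h).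
Proof.
move=> z; rewrite /quad.
have c1 : w.1 @[w --> z] --> z.1 by exact: cvg_fst.
have c2 : w.2 @[w --> z] --> z.2 by exact: cvg_snd.
have cM (c l : R) (f : R * R -> R) : f w @[w --> z] --> l ->
    c * f w @[w --> z] --> c * l by move=> fl; apply: cvgM => //; exact: cvg_cst.
apply: cvgD (cM h _ _ (cvgM c2 c2)).
apply: cvgD (cvgM (cM e _ _ c1) c2).
apply: cvgD (cM d _ _ (cvgM c1 c1)).
apply: cvgD (cM g _ _ c2).
by apply: cvgD (cM b _ _ c1); exact: cvg_cst.
Qed.

(** If p were nonzero at z, it would be nonzero near z, and a neighborhood of a point of the closed
    rectangle meets the open one in a nonempty open set, which is not null. *)
Lemma P2_ae_eq0 (p : R * R -> R) Q z : is_P2 p -> xl Q < xr Q -> yb Q < yt Q ->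
  (\forall w \ae leb2 R, open_rect Q w -> p w = 0) -> rect_set Q z -> p z = 0.
Proof.
move=> /is_P2_quad[a [b [g [d [e [h pE]]]]]] xx yy p0 Qz.
apply: contrapT => /eqP pz.
have nb : nbhs z [set w | p w != 0].
  have /(_ z) cp : continuous p by rewrite pE; exact: continuous_quad.
  apply: (cp [set x | x != 0]); apply: open_nbhs_nbhs.
  by split; [exact: open_neq | exact: pz].
pose U := [set w | p w != 0]° `&` open_rect Q.
have [w Uw] : U !=set0.
  apply/set0P/eqP => U0.
  apply: (@disjoint_not_interior _ Q [set w | p w != 0]° z) => //.
    by rewrite setIC.
  exact: nbhs_interior.
have nU : nbhs w U.
  apply: open_nbhs_nbhs; split=> [|//].
  by apply: openI; [exact: open_interior | exact: open_open_rect].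
apply: (negligible_not_nbhs nU); apply: negligibleS p0 => v [v1 v2] /(_ v2).
by have /eqP := interior_subset v1.
Qed.

End Measure.

(** * From the patch to the whole domain *)

Section Extension.
Variables (R : realType) (T : finType) (cell : T -> rect R).
Variable Omega : set (R * R).
Hypothesis grid : rectangular_grid cell Omega.
Hypothesis regO : (closure Omega)° = Omega.
Implicit Types (K Q : T) (z : R * R).

Lemma patch_disjoint M Q : ~ patch_cells M Q ->
  open_rect (cell Q) `&` patch_domain cell M = set0.
Proof.
move=> MQ; apply/seteqP; split => // z [Qz [L ML Lz]]; apply: MQ.
suff -> : Q = L by [].
apply: contrapT => QL.
apply: (@disjoint_not_interior _ (cell L) (open_rect (cell Q)) z) => //.
- exact: (cell_ltx grid).
- exact: (cell_lty grid).
- apply/seteqP; split => // w [w1 w2]; apply: QL.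
  exact: (open_rect_cell_inj grid w2 w1).
- by apply: open_nbhs_nbhs; split => //; exact: open_open_rect.
Qed.

Lemma basis_fun_out M (phi : R * R -> R) Q z :
  (forall z, ~ patch_domain cell M z -> phi z = 0) ->
  ~ patch_cells M Q -> open_rect (cell Q) z -> phi z = 0.
Proof.
move=> phi0 MQ Qz; apply: phi0 => Dz.
by have : set0 z by rewrite -(patch_disjoint MQ).
Qed.

(** The reason why extension by zero is conforming: whatever a patch shares with an outer cell lies
    on the patch boundary, where vertex values and edge means vanish. *)
Lemma out_frontier M Q z : ~ patch_cells M Q -> rect_set (cell Q) z ->
  patch_domain cell M z -> frontier (patch_domain cell M) z.
Proof.
move=> MQ Qz Dz; split; first exact: subset_closure.
apply: (@disjoint_not_interior _ (cell Q)) => //.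
- exact: (cell_ltx grid).
- exact: (cell_lty grid).
- exact: patch_disjoint.
Qed.

Lemma patch_cell_sub M Q : patch_cells M Q ->
  rect_set (cell Q) `<=` patch_domain cell M.
Proof. by move=> MQ z Qz; exists Q. Qed.

(** The interior of a patch is an open subset of the closure of Omega, hence of Omega, so the
    boundary of Omega does not pass through it. The boundary conditions on the patch thus imply
    those on Omega. *)
Lemma domain_frontier M z : patch_domain cell M z -> frontier Omega z ->
  frontier (patch_domain cell M) z.
Proof.
move=> Dz [_ Oz]; split; first exact: subset_closure.
move=> Diz; apply: Oz.
suff : (patch_domain cell M)° `<=` Omega.
  by rewrite open_subsetE; [exact | exact: open_interior].
apply: (open_sub_domain regO); first exact: open_interior.
move=> w /interior_subset[Q _ Qw]; exact: (cell_sub_closure grid Qw).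
Qed.

Lemma vertex_in_cell K z : is_vertex (cell K) z -> rect_set (cell K) z.
Proof.
rewrite rect_setE => -[hx hy]; have := cell_ltx grid K; have := cell_lty grid K.
by split; [case: hx => -> | case: hy => ->]; lra.
Qed.

Lemma edge_in_cell K e : is_edge (cell K) e -> edge_set e `<=` rect_set (cell K).
Proof.
have := cell_ltx grid K; have := cell_lty grid K => hy hx.
by case=> -> [x y] /=; rewrite rect_setE /= ?in_itv /= => -[/= + +];
  rewrite ?in_itv /= => h1 h2; rewrite ?h1 ?h2; split; lra.
Qed.

Lemma mean_dn_zero K e : is_edge (cell K) e -> mean_dn e (fun=> 0 : R) = 0.
Proof.
have := cell_ltx grid K; have := cell_lty grid K => hy hx.
by case=> ->; rewrite ?mean_dn_VEdge ?mean_dn_HEdge ?subrr ?mul0r //;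
  exact: is_P2_0.
Qed.

(** Each simple function below f on A, extended by zero, is also below f on D. *)
Lemma ge0_integral_extend (D : set (R * R)) (f : R * R -> \bar R) (A : set (R * R)) :
  (forall z, (0 <= f z)%E) -> (forall z, ~ D z -> f z = 0%E) ->
  (\int[leb2 R]_(z in A) f z <= \int[leb2 R]_(z in D) f z)%E.
Proof.
move=> f0 fD; rewrite !ge0_integralE //.
apply: ereal_sup_le => _ [h /= hf <-]; exists h => //= z.
apply: (le_trans (hf z)); rewrite /patch; case: ifPn => _; case: ifPn => //.
by move=> /negP zD; rewrite fD // => Dz; apply: zD; rewrite inE.
Qed.

Lemma RRM_extension M (phi : R * R -> R) p :
  (forall z, ~ patch_domain cell M z -> phi z = 0) ->
  RRM_pieces cell (patch_domain cell M) (patch_cells M) phi p ->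
  RRM cell Omega [set: T] phi.
Proof.
set D := patch_domain cell M => phi0 [[mphi iphi] pP cv ce [bv be]].
pose p' Q := if `[< patch_cells M Q >] then p Q else fun=> 0 : R.
have p'in Q : patch_cells M Q -> p' Q = p Q by move=> /asboolP MQ; rewrite /p' MQ.
have p'out Q : ~ patch_cells M Q -> p' Q = fun=> 0.
  by move=> /asboolPn/negPf MQ; rewrite /p' MQ.
have mD : measurable (D : set (measurableTypeR R * measurableTypeR R)%type).
  apply: fin_bigcup_measurable; first exact: finite_finset.
  by move=> Q _; exact: measurable_rect_set.
exists p'; split.
- split.
    apply: (@measurable_funS _ _ _ _ setT) => //.
    rewrite -(setUv D); apply/measurable_funU => //; first exact: measurableC.
    split => // mC Y mY.
    have -> : ~` D `&` phi @^-1` Y = ~` D `&` (fun=> 0 : R) @^-1` Y.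
      by apply/seteqP; split => z [/= Dz]; rewrite (phi0 z Dz).
    exact: (@measurable_cst _ _ _ (measurableTypeR R) _ 0).
  apply: le_lt_trans iphi; apply: ge0_integral_extend.
    by move=> z; rewrite lee_fin sqr_ge0.
  by move=> z /phi0 ->; rewrite expr0n.
- move=> Q _; have [MQ|MQ] := pselect (patch_cells M Q).
    by rewrite p'in //; exact: pP.
  rewrite p'out //; split; first exact: is_P2_0.
  apply: leb2_aeS (ae_open_rect (cell Q)) => z /[apply].
  exact: (basis_fun_out phi0 MQ).
- move=> z Oz K K' _ _ Kz K'z.
  have out H H' : patch_cells M H -> ~ patch_cells M H' ->
      is_vertex (cell H) z -> is_vertex (cell H') z -> p H z = 0.
    move=> MH MH' Hz H'z; apply: bv => //.
    apply: (out_frontier MH'); first exact: vertex_in_cell.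
    by apply: (patch_cell_sub MH); exact: vertex_in_cell.
  have [MK|MK] := pselect (patch_cells M K);
    have [MK'|MK'] := pselect (patch_cells M K').
  + rewrite (p'in _ MK) (p'in _ MK').
    (* A vertex inside Omega may lie on the patch boundary, where both values are zero. *)
    have [Fz|Fz] := pselect (frontier D z); last exact: cv.
    by rewrite (bv _ Fz _ MK Kz) (bv _ Fz _ MK' K'z).
  + by rewrite (p'in _ MK) (p'out _ MK') (out K K' MK MK' Kz K'z).
  + by rewrite (p'out _ MK) (p'in _ MK') (out K' K MK' MK K'z Kz).
  + by rewrite (p'out _ MK) (p'out _ MK').
- move=> e Oe K K' _ _ Ke K'e.
  have out H H' : patch_cells M H -> ~ patch_cells M H' ->
      is_edge (cell H) e -> is_edge (cell H') e -> mean_dn e (p H) = 0.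
    move=> MH MH' He H'e; apply: be => // z ez.
    apply: (out_frontier MH'); first exact: edge_in_cell H'e _ ez.
    by apply: (patch_cell_sub MH); exact: edge_in_cell He _ ez.
  have [MK|MK] := pselect (patch_cells M K);
    have [MK'|MK'] := pselect (patch_cells M K').
  + rewrite (p'in _ MK) (p'in _ MK').
    have [Fe|Fe] := pselect (edge_set e `<=` frontier D); last exact: ce.
    by rewrite (be _ Fe _ MK Ke) (be _ Fe _ MK' K'e).
  + by rewrite (p'in _ MK) (p'out _ MK') (out K K' MK MK' Ke K'e) (mean_dn_zero Ke).
  + by rewrite (p'out _ MK) (p'in _ MK') (out K' K MK' MK K'e Ke) (mean_dn_zero Ke).
  + by rewrite (p'out _ MK) (p'out _ MK').
- split=> [z Oz K _ Kz|e Oe K _ Ke]; have [MK|MK] := pselect (patch_cells M K).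
  + rewrite (p'in _ MK); apply: bv => //; apply: domain_frontier => //.
    by apply: (patch_cell_sub MK); exact: vertex_in_cell.
  + by rewrite (p'out _ MK).
  + rewrite (p'in _ MK); apply: be => // z ez.
    apply: domain_frontier; last exact: Oe.
    by apply: (patch_cell_sub MK); exact: edge_in_cell Ke _ ez.
  + by rewrite (p'out _ MK) (mean_dn_zero Ke).
Qed.

Lemma RRM_basis_fun K phi : is_RRM_basis_fun cell K phi ->
  RRM cell Omega [set: T] phi.
Proof. by case=> M [_ [phi0 [p [pP _]]]]; exact: (RRM_extension phi0 pP). Qed.

Variable phi : T -> R * R -> R.
Hypothesis phiE : forall K, interior_cell cell Omega K ->
  is_RRM_basis_fun cell K (phi K).

(* On the lower-left cell of the patch of K, only cells to the lower left of K
   contribute, so a coefficient that is nonzero at a lower-left-most cell is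
   detected there. *)
Lemma basis_independent (d : T -> R) :
  (\forall z \ae leb2 R, Omega z ->
     \sum_(K | `[< interior_cell cell Omega K >]) d K * phi K z = 0) ->
  forall K, interior_cell cell Omega K -> d K = 0.
Proof.
move=> ae0 K1 K1int; apply: contrapT => /eqP dK1.
pose P K := `[< interior_cell cell Omega K >] && (d K != 0).
have PK1 : P K1 by rewrite /P dK1 andbT; apply/asboolP.
(* Minimality of the coordinate sum is enough: a competing cell weakly to the left of K and weakly
   below it must have the same corner. *)
case: (@Order.TotalTheory.arg_minP _ R T K1 P
  (fun K => xl (cell K) + yb (cell K)) PK1) => K /andP[/asboolP Kint dK] Kmin.
have [M [patchM [phi0 [p [pP pval]]]]] := phiE Kint.
have cx := cell_ltx grid; have cy := cell_lty grid.
pose Q := M 0%N 0%N.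
have MQ : patch_cells M Q by exists 0%N, 0%N.
have [q1 q2 q3 q4] := patch_cellE patchM (isT : 0 < 3)%N (isT : 0 < 3)%N.
have [k1 k2 k3 k4] := patch_cellE patchM (isT : 1 < 3)%N (isT : 1 < 3)%N.
have MK : M 1%N 1%N = K by case: patchM.
rewrite MK in k1 k2 k3 k4.
have other K' : interior_cell cell Omega K' -> K' <> K ->
    forall z, open_rect (cell Q) z -> d K' * phi K' z = 0.
  move=> K'int K'K z Qz; have [->|dK'] := eqVneq (d K') 0; first by rewrite mul0r.
  have [M' [patchM' [phi0' _]]] := phiE K'int.
  rewrite (basis_fun_out phi0' _ Qz) ?mulr0 // => -[i [j [i3 j3 QM]]].
  have [r1 r2 r3 r4] := patch_cellE patchM' i3 j3.
  have [l1 l2 l3 l4] := patch_cellE patchM' (isT : 1 < 3)%N (isT : 1 < 3)%N.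
  have MK' : M' 1%N 1%N = K' by case: patchM'.
  rewrite MK' in l1 l2 l3 l4; rewrite -QM /Q in r1 r2 r3 r4.
  (* Q is at position (i, j) in the patch of K', so [xl (cell K')] is knot 1, which is at most knot
     [i.+1], the right side of Q and left side of K. *)
  have lex : xl (cell K') <= xl (cell K).
    rewrite k1 l1 -q2 r2; case: i i3 {r1 QM r2} => [|i] i3 //.
    by apply: (knotx_homo cx patchM'); lia.
  have ley : yb (cell K') <= yb (cell K).
    rewrite k3 l3 -q4 r4; case: j j3 {r3 QM r4} => [|j] j3 //.
    by apply: (knoty_homo cy patchM'); lia.
  have : xl (cell K) + yb (cell K) <= xl (cell K') + yb (cell K').
    by apply: Kmin; rewrite /P dK' andbT; apply/asboolP.
  by move=> h; apply: K'K; apply: (cell_eqP grid); lra.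
have pQ : is_P2 (p Q) /\ ae_eq (leb2 R) (rect_set (cell Q)) (phi K) (p Q).
  by case: pP => _ /(_ Q MQ).
have QO : open_rect (cell Q) `<=` Omega.
  apply: (open_sub_domain regO); first exact: open_open_rect.
  by apply: subset_trans (cell_sub_closure grid (K := Q)); exact: open_rect_sub.
have pQ0 : \forall z \ae leb2 R, open_rect (cell Q) z -> p Q z = 0.
  apply: leb2_aeS (leb2_aeI ae0 pQ.2) => z [h1 h2] Qz.
  have := h1 (QO _ Qz); rewrite (bigD1 K) /=; last exact/asboolP.
  rewrite big1 ?addr0; last by move=> K' /andP[/asboolP K'int /eqP K'K]; exact: other.
  rewrite h2; last exact: open_rect_sub.
  by move=> /eqP; rewrite mulf_eq0 (negPf dK) => /eqP.
(* The upper right vertex of Q is the lower left vertex of K, where the piece has the nonzero value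
   prescribed for [phi K]. *)
have := @P2_ae_eq0 _ (p Q) (cell Q) (knotx cell M 1, knoty cell M 1) pQ.1
  (cx _) (cy _) pQ0.
rewrite rect_setE /= -q2 -q4 !lexx !andbT => /(_ (conj (ltW (cx _)) (ltW (cy _)))).
have := @basis_vertexE _ _ _ cx cy _ _ patchM _ _ pP pval 1 1 0 0 isT isT isT isT.
rewrite q2 q4 -/Q => -> /eqP; rewrite mulf_eq0.
rewrite (negPf (bsplinex1_neq0 cx patchM)).
by rewrite (negPf (bspliney1_neq0 cy patchM)).
Qed.

End Extension.

(** * Coloring the cells of a simply connected domain *)

Section Polyline.
Variable R : realType.

Definition clamp (s : R) : R := Num.max 0 (Num.min 1 s).

Lemma continuous_clamp : continuous clamp.
Proof.
move=> s; rewrite /clamp; apply: (@continuous_max _ R (fun=> 0) (fun s => Num.min 1 s)).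
  exact: cvg_cst.
by apply: (@continuous_min _ R (fun=> 1) id); [exact: cvg_cst | exact: cvg_id].
Qed.

(** A sum of clamped increments is continuous without any gluing; on the m-th unit interval the
    earlier increments are complete and telescope, the later ones are zero. *)
Definition polypath (c : nat -> R * R) (n : nat) (u : R) : R * R :=
  c 0%N + \sum_(0 <= k < n) clamp (u - k%:R) *: (c k.+1 - c k).

Lemma continuous_polypath c n : continuous (polypath c n).
Proof.
elim: n => [|n IH] u.
  rewrite (_ : polypath c 0 = cst (c 0%N)); first exact: cst_continuous.
  by apply/funext => v; rewrite /polypath big_nil addr0.
rewrite (_ : polypath c n.+1 =
  fun v => polypath c n v + clamp (v - n%:R) *: (c n.+1 - c n)); last first.
  by apply/funext => v; rewrite /polypath big_nat_recr //= addrA.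
apply: continuousD; first exact: IH.
apply: cvgZr_tmp.
apply: (@cvg_comp _ _ _ (fun v => v - n%:R) clamp _ (nbhs (u - n%:R))).
  by apply: cvgB; [exact: cvg_id | exact: cvg_cst].
exact: continuous_clamp.
Qed.

Lemma polypathE c n m u : (m < n)%N -> m%:R <= u <= m.+1%:R ->
  polypath c n u = c m + (u - m%:R) *: (c m.+1 - c m).
Proof.
move=> mn um; rewrite /polypath.
rewrite (@big_cat_nat _ _ _ m) //=; last exact: ltnW.
rewrite (@big_ltn _ _ _ m) //.
have -> : \sum_(m.+1 <= k < n) clamp (u - k%:R) *: (c k.+1 - c k) = 0.
  rewrite big_nat_cond big1 // => k /andP[/andP[mk kn] _].
  have : m.+1%:R <= k%:R :> R by rewrite ler_nat.
  move=> mk'; rewrite /clamp max_l ?scale0r //.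
  by rewrite ge_min; apply/orP; right; lra.
rewrite addr0 (@eq_big_nat _ _ _ 0 m _ (fun k => c k.+1 - c k)); last first.
  move=> k /andP[_ km].
  have : k.+1%:R <= m%:R :> R by rewrite ler_nat.
  rewrite -natr1 => km'; rewrite /clamp min_l; last lra.
  by rewrite max_r ?scale1r.
rewrite telescope_sumr // addrA subrKC; congr (_ + _ *: _).
by rewrite -natr1 in um; rewrite /clamp min_r ?max_r //; lra.
Qed.

Lemma nat_segment n (u : R) : (0 < n)%N -> 0 <= u <= n%:R ->
  exists2 m, (m < n)%N & m%:R <= u <= m.+1%:R.
Proof.
elim: n => // n IH _ /andP[u0 un].
have [un'|un'] := leP u n%:R; last by exists n => //; rewrite ltW.
case: n => [|n] in IH un un' *.
  by exists 0%N => //; rewrite u0.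
by have [||m mn mu] := IH; rewrite ?u0 // => //; exists m => //; exact: ltnW.
Qed.

End Polyline.

(** * The parity cocycle and its invariance under homotopy *)

Section Coloring.
Variables (R : realType) (T : finType) (cell : T -> rect R).
Variable Omega : set (R * R).
Hypothesis grid : rectangular_grid cell Omega.
Hypothesis regO : (closure Omega)° = Omega.
Implicit Types (K : T) (z w : R * R).

(* kappa is the parity of the number of grid lines separating two touching
   cells. *)
Definition kappa K K' :=
  (xl (cell K) != xl (cell K')) (+) (yb (cell K) != yb (cell K')).

Definition quadrant w K := (xl (cell K) < w.1) (+) (yb (cell K) < w.2).

(** At a common point the left sides of two cells differ only if w is on the right side of one and
    on the left side of the other; likewise for lower sides. So [kappa] is locally a coboundary. *)
Lemma kappa_quadrant K K' w : rect_set (cell K) w -> rect_set (cell K') w ->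
  kappa K K' = quadrant w K (+) quadrant w K'.
Proof.
move=> Kw K'w; rewrite /kappa /quadrant addbACA.
have := (cell_ltx grid K, cell_ltx grid K', cell_lty grid K, cell_lty grid K').
move=> -[[[a b] c] d].
have [cx cy] := (touching_columns grid Kw K'w, touching_rows grid Kw K'w).
move: Kw K'w; rewrite !rect_setE => -[kx ky] [kx' ky'].
congr addb.
  case: cx => [[-> _]|h|h]; first by rewrite eqxx addbb.
    have [-> ->] : (xl (cell K) < w.1) /\ (xl (cell K') < w.1) = false.
      by split; [lra | apply/negbTE; rewrite -leNgt; lra].
    by rewrite (_ : _ != _) //; apply/eqP; lra.
  have [-> ->] : (xl (cell K) < w.1) = false /\ (xl (cell K') < w.1).
    by split; [apply/negbTE; rewrite -leNgt; lra | lra].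
  by rewrite (_ : _ != _) //; apply/eqP; lra.
case: cy => [[-> _]|h|h]; first by rewrite eqxx addbb.
  have [-> ->] : (yb (cell K) < w.2) /\ (yb (cell K') < w.2) = false.
    by split; [lra | apply/negbTE; rewrite -leNgt; lra].
  by rewrite (_ : _ != _) //; apply/eqP; lra.
have [-> ->] : (yb (cell K) < w.2) = false /\ (yb (cell K') < w.2).
  by split; [apply/negbTE; rewrite -leNgt; lra | lra].
by rewrite (_ : _ != _) //; apply/eqP; lra.
Qed.

(** The common point is essential: three consecutive cells of a row violate the identity. *)
Lemma kappa_cocycle K1 K2 K3 w : rect_set (cell K1) w ->
  rect_set (cell K2) w -> rect_set (cell K3) w ->
  kappa K1 K2 (+) kappa K2 K3 = kappa K1 K3.
Proof.
move=> h1 h2 h3; rewrite (kappa_quadrant h1 h2) (kappa_quadrant h2 h3).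
rewrite (kappa_quadrant h1 h3).
by case: (quadrant w K1) (quadrant w K2) (quadrant w K3) => [] [] [].
Qed.

Lemma kappa_refl K : kappa K K = false.
Proof. by rewrite /kappa !eqxx. Qed.

Definition adjacent_cells K K' : Prop := [\/ left_of cell K K', left_of cell K' K,
  below cell K K' | below cell K' K].

Lemma kappa_adjacent K K' : adjacent_cells K K' -> kappa K K' = true.
Proof.
have := (cell_ltx grid K, cell_ltx grid K', cell_lty grid K, cell_lty grid K').
move=> -[[[a b] c] d]; rewrite /kappa.
case=> -[h1 h2 h3].
- by rewrite h2 eqxx addbF; apply/eqP; lra.
- by rewrite h2 eqxx addbF; apply/eqP; lra.
- by rewrite h2 eqxx; apply/eqP; lra.
- by rewrite h2 eqxx; apply/eqP; lra.
Qed.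

(** A discrete Stokes argument: by the cocycle identity the sum of [kappa] around each mesh square
    is zero, so all rows have the same sum, and the last row is constant. *)
Lemma discrete_homotopy (f : nat -> nat -> T) (N : nat) (c : T) :
  (forall i j, (i < N)%N -> (j < N)%N -> exists w,
    [/\ rect_set (cell (f i j)) w, rect_set (cell (f i j.+1)) w,
        rect_set (cell (f i.+1 j)) w & rect_set (cell (f i.+1 j.+1)) w]) ->
  (forall i, (i <= N)%N -> f i 0%N = c /\ f i N = c) ->
  (forall j, (j <= N)%N -> f N j = c) ->
  \big[addb/false]_(0 <= j < N) kappa (f 0%N j) (f 0%N j.+1) = false.
Proof.
move=> square sides last.
pose r i m := \big[addb/false]_(0 <= j < m) kappa (f i j) (f i j.+1).
have step i m : (i < N)%N -> (m <= N)%N ->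
    r i m (+) kappa (f i m) (f i.+1 m) =
    kappa (f i 0%N) (f i.+1 0%N) (+) r i.+1 m.
  move=> iN; elim: m => [|m IH] mN.
    by rewrite /r !big_nil addbF.
  have := IH (ltnW mN); rewrite /r !big_nat_recr //=.
  set A := \big[_/_]_(_ <= _ < _) _; set B := \big[_/_]_(_ <= _ < _) _ => e.
  have [w [w1 w2 w3 w4]] := square i m iN mN.
  have e1 := kappa_cocycle w1 w2 w4.
  have e2 := kappa_cocycle w1 w3 w4.
  by rewrite -[LHS]addbA e1 -e2 [LHS]addbA e -addbA.
have rc i : (i <= N)%N -> r i N = r N N.
  move=> iN; rewrite -(subKn iN).
  elim: (N - i)%N (leq_subr i N) => [_|k IH kN]; first by rewrite subn0.
  have kN' : (N - k.+1 < N)%N by lia.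
  have := step _ N kN' (leqnn N).
  have -> : (N - k.+1).+1 = (N - k)%N by lia.
  rewrite {}IH 1?ltnW //.
  have [-> ->] := sides _ (leq_subr k.+1 N).
  have [-> ->] := sides _ (leq_subr k N).
  by rewrite kappa_refl addbF addFb.
rewrite [LHS](rc 0%N) // /r big_nat_cond big1 // => j; rewrite andbT => /andP[_ jN].
by rewrite !last ?kappa_refl // ltnW.
Qed.

Lemma cell_unique K L z : open_rect (cell K) z -> rect_set (cell L) z -> L = K.
Proof.
move=> Kz Lz; apply: contrapT => LK.
apply: (@disjoint_not_interior _ (cell L) (open_rect (cell K)) z) => //.
- exact: (cell_ltx grid).
- exact: (cell_lty grid).
- apply/seteqP; split => // w [w1 w2]; apply: LK.
  exact: (open_rect_cell_inj grid w1 w2).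
- by move: z Kz {Lz}; rewrite -/(subset _ _) -open_subsetE //; exact: open_open_rect.
Qed.

(** The cells are closed and finitely many, so those that miss z also miss a neighborhood of it. *)
Lemma near_star z :
  \forall z' \near z, forall K, rect_set (cell K) z' -> rect_set (cell K) z.
Proof.
apply: (@filter_forall _ T
  (fun K z' => rect_set (cell K) z' -> rect_set (cell K) z) _
  (nbhs_filter z)) => K.
have [Kz|Kz] := pselect (rect_set (cell K) z); first exact: nearW.
have : nbhs z (~` rect_set (cell K)).
  by apply: open_nbhs_nbhs; split => //; apply: closed_openC; exact: closed_rect_set.
by apply: filterS => w nKw /nKw.
Qed.

Let unit_square : set (R * R) := `[0, 1] `*` `[0, 1].

(** Compactness makes the neighborhoods of [near_star] uniform: all cells met by H on a small mesh
    square contain one point w, as the cocycle identity requires. *)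
Lemma lebesgue_number (H : R * R -> R * R) : {within unit_square, continuous H} ->
  exists2 e : R, 0 < e & forall a, unit_square a -> exists w, forall a',
    unit_square a' -> `|a.1 - a'.1| < e -> `|a.2 - a'.2| < e ->
    forall K, rect_set (cell K) (H a') -> rect_set (cell K) w.
Proof.
move=> /subspace_continuousP cH.
have cpt : compact unit_square by apply: compact_setX; exact: segment_compact.
move/compact_near_coveringP: cpt => /(_ R (0 : R)^'+ (fun e a =>
  exists w, forall a', unit_square a' -> `|a.1 - a'.1| < e -> `|a.2 - a'.2| < e ->
    forall K, rect_set (cell K) (H a') -> rect_set (cell K) w)).
have star a : unit_square a -> \forall b \near a & e \near (0 : R)^'+,
    exists w, forall a', unit_square a' -> `|b.1 - a'.1| < e ->
      `|b.2 - a'.2| < e ->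
      forall K, rect_set (cell K) (H a') -> rect_set (cell K) w.
  move=> Sa; have := cH a Sa _ (near_star (H a)).
  rewrite /= /within /= => /nbhs_ballP[e /= e0 ae].
  exists (ball a (e / 2), [set e' : R | 0 < e' < e / 2]) => /=.
    split; first by apply: nbhsx_ballx; rewrite divr_gt0.
    near=> t; apply/andP; split; near: t; first exact: nbhs_right_gt.
    by apply: nbhs_right_lt; rewrite divr_gt0.
  move=> [b e'] /= [[ab1 ab2] /andP[e'0 e'e]].
  exists (H a) => a' Sa' b1 b2; apply: (ae a') => //.
  rewrite /ball /= in ab1 ab2.
  split; rewrite /ball /=.
    by apply: le_lt_trans (ler_distD b.1 _ _) _; lra.
  by apply: le_lt_trans (ler_distD b.2 _ _) _; lra.
move=> /(_ _ star) near_e.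
have : \forall e \near (0 : R)^'+, 0 < e /\ unit_square `<=` (fun a =>
  exists w, forall a', unit_square a' -> `|a.1 - a'.1| < e -> `|a.2 - a'.2| < e ->
    forall K, rect_set (cell K) (H a') -> rect_set (cell K) w).
  by apply: filterI => //; exact: nbhs_right_gt.
by move=> /filter_ex[e [e0 eP]]; exists e.
Unshelve. all: by end_near. Qed.

Hypothesis scO : simply_connected Omega.

(** On grid lines the choice is arbitrary, which is harmless because the cocycle identity holds for
    any cells through the point; [K0] is only a default. *)
Definition cell_at (K0 : T) z : T := xget K0 [set K | rect_set (cell K) z].

Lemma cell_atP K0 z : Omega z -> rect_set (cell (cell_at K0 z)) z.
Proof.
move=> /(@subset_closure _ Omega); case: grid => _ -> _ _ [K _ Kz].
by rewrite /cell_at; case: xgetP => [L -> //|/(_ K)].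
Qed.

Lemma cell_at_open K0 K z : Omega z -> open_rect (cell K) z ->
  cell_at K0 z = K.
Proof. by move=> Oz Kz; apply: (cell_unique Kz); exact: cell_atP. Qed.

Lemma rect_center_cell K : open_rect (cell K) (rect_center (cell K)).
Proof. by apply: rect_center_open; [exact: (cell_ltx grid) | exact: (cell_lty grid)]. Qed.

Lemma open_rect_domain K : open_rect (cell K) `<=` Omega.
Proof.
apply: (open_sub_domain regO); first exact: open_open_rect.
by apply: subset_trans (cell_sub_closure grid (K := K)); exact: open_rect_sub.
Qed.

Let ctr K := rect_center (cell K).

(* w is where the segment between the two centers crosses the common edge. *)
Lemma adjacent_segment K K' : adjacent_cells K K' -> exists w, forall s : R, 0 <= s <= 1 ->
  let z := ctr K + s *: (ctr K' - ctr K) in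
  Omega z /\ forall L, rect_set (cell L) z -> rect_set (cell L) w.
Proof.
have sym H H' : (exists w, forall s : R, 0 <= s <= 1 ->
  let z := ctr H + s *: (ctr H' - ctr H) in
  Omega z /\ forall L, rect_set (cell L) z -> rect_set (cell L) w) ->
  exists w, forall s : R, 0 <= s <= 1 ->
  let z := ctr H' + s *: (ctr H - ctr H') in
  Omega z /\ forall L, rect_set (cell L) z -> rect_set (cell L) w.
  move=> [w hw]; exists w => s s01 /=.
  have -> : ctr H' + s *: (ctr H - ctr H') = ctr H + (1 - s) *: (ctr H' - ctr H).
    by congr pair; rewrite /= /GRing.scale /=; ring.
  by apply: hw; lra.
have horiz H H' : left_of cell H H' -> exists w, forall s : R, 0 <= s <= 1 ->
  let z := ctr H + s *: (ctr H' - ctr H) in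
  Omega z /\ forall L, rect_set (cell L) z -> rect_set (cell L) w.
  case=> h1 h2 h3.
  have := (cell_ltx grid H, cell_ltx grid H', cell_lty grid H, cell_lty grid H').
  move=> -[[[a b] c] d].
  exists (xr (cell H), (yb (cell H) + yt (cell H)) / 2) => s s01.
  have -> : ctr H + s *: (ctr H' - ctr H) =
    ((xl (cell H) + xr (cell H)) / 2 + s * ((xr (cell H') - xl (cell H)) / 2),
     (yb (cell H) + yt (cell H)) / 2).
    by congr pair; rewrite /= /GRing.scale /= ?h1 -?h2 -?h3; field.
  set x := _ + s * _.
  have xH : xl (cell H) < x < xr (cell H').
    by rewrite /x; apply/andP; split; nra.
  move=> z; split.
    (* The two cells fill one rectangle, so its interior, including the open common edge, is in
       Omega by regularity. *)
    pose Q := Rect (xl (cell H)) (xr (cell H')) (yb (cell H)) (yt (cell H)).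
    have : open_rect Q z by rewrite open_rectE /=; split => //; lra.
    apply: (open_sub_domain regO); first exact: open_open_rect.
    move=> v; rewrite open_rectE /= => -[v1 v2].
    have [v1'|v1'] := leP v.1 (xr (cell H)).
      by apply: (cell_sub_closure grid (K := H)); rewrite rect_setE; lra.
    by apply: (cell_sub_closure grid (K := H')); rewrite rect_setE; lra.
  (* Off the common edge the point is in a single open cell, which contains w; on the edge it is w
     itself. *)
  move=> L Lz; have [x1|x1|x1] := ltgtP x (xr (cell H)); last by rewrite -x1.
    have -> : L = H by apply: (cell_unique _ Lz); rewrite open_rectE /=; lra.
    by rewrite rect_setE /=; lra.
  have -> : L = H' by apply: (cell_unique _ Lz); rewrite open_rectE /=; lra.
  by rewrite rect_setE /=; lra.
have vert H H' : below cell H H' -> exists w, forall s : R, 0 <= s <= 1 ->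
  let z := ctr H + s *: (ctr H' - ctr H) in
  Omega z /\ forall L, rect_set (cell L) z -> rect_set (cell L) w.
  case=> h1 h2 h3.
  have := (cell_ltx grid H, cell_ltx grid H', cell_lty grid H, cell_lty grid H').
  move=> -[[[a b] c] d].
  exists ((xl (cell H) + xr (cell H)) / 2, yt (cell H)) => s s01.
  have -> : ctr H + s *: (ctr H' - ctr H) =
    ((xl (cell H) + xr (cell H)) / 2,
     (yb (cell H) + yt (cell H)) / 2 + s * ((yt (cell H') - yb (cell H)) / 2)).
    by congr pair; rewrite /= /GRing.scale /= ?h1 -?h2 -?h3; field.
  set x := _ + s * _.
  have xH : yb (cell H) < x < yt (cell H').
    by rewrite /x; apply/andP; split; nra.
  move=> z; split.
    pose Q := Rect (xl (cell H)) (xr (cell H)) (yb (cell H)) (yt (cell H')).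
    have : open_rect Q z by rewrite open_rectE /=; split => //; lra.
    apply: (open_sub_domain regO); first exact: open_open_rect.
    move=> v; rewrite open_rectE /= => -[v1 v2].
    have [v1'|v1'] := leP v.2 (yt (cell H)).
      by apply: (cell_sub_closure grid (K := H)); rewrite rect_setE; lra.
    by apply: (cell_sub_closure grid (K := H')); rewrite rect_setE; lra.
  move=> L Lz; have [x1|x1|x1] := ltgtP x (yt (cell H)); last by rewrite -x1.
    have -> : L = H by apply: (cell_unique _ Lz); rewrite open_rectE /=; lra.
    by rewrite rect_setE /=; lra.
  have -> : L = H' by apply: (cell_unique _ Lz); rewrite open_rectE /=; lra.
  by rewrite rect_setE /=; lra.
by case=> [/horiz|/horiz/sym|/vert|/vert/sym].
Qed.

(* A closed walk of cells gives a closed polygonal line through their centers;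
   contracting it and counting grid-line crossings modulo 2 along a fine mesh of
   the homotopy shows that the walk has even length. *)
Lemma closed_walk_even (c : nat -> T) n :
  (forall i, (i < n)%N -> adjacent_cells (c i) (c i.+1)) -> c n = c 0%N -> ~~ odd n.
Proof.
move=> adj cn; have [->//|n0] := posnP n.
have nR : 0 < n%:R :> R by rewrite ltr0n.
pose g (t : R) := polypath (ctr \o c) n (t * n%:R).
have cg : continuous g.
  move=> t; apply: (@cvg_comp _ _ _ (fun t => t * n%:R) (polypath (ctr \o c) n) _
    (nbhs (t * n%:R))); last exact: continuous_polypath.
  by apply: cvgM; [exact: cvg_id | exact: cvg_cst].
have gE m (t : R) : (m < n)%N -> m%:R <= t * n%:R <= m.+1%:R ->
    g t = ctr (c m) + (t * n%:R - m%:R) *: (ctr (c m.+1) - ctr (c m)).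
  by move=> mn mt; rewrite /g (@polypathE _ _ n m).
(* [w m] belongs to every cell met by the m-th segment; 0 is a dummy beyond the walk. *)
have /choice[w wP] : forall m, exists w, (m < n)%N ->
    forall t : R, m%:R <= t * n%:R <= m.+1%:R ->
    Omega (g t) /\ forall L, rect_set (cell L) (g t) -> rect_set (cell L) w.
  move=> m; have [mn|] := ltnP m n; last by exists 0.
  have [w wP] := adjacent_segment (adj m mn); exists w => _ t mt.
  by rewrite (gE m) //; apply: wP; rewrite -natr1 in mt; lra.
have Og : g @` `[0, 1] `<=` Omega.
  move=> _ [t + <-]; rewrite /= in_itv /= => /andP[t0 t1].
  have [|m mn mt] := @nat_segment _ n (t * n%:R) n0.
    apply/andP; split; first by rewrite mulr_ge0 // ltW.
    by apply: ler_piMl => //; exact: ltW.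
  by case: (wP m mn t mt).
have g0 : g 0 = ctr (c 0%N).
  by rewrite (gE 0%N) // ?mul0r ?lexx ?ler01 // subrr scale0r addr0.
have gi i : (i <= n)%N -> g (i%:R / n%:R) = ctr (c i).
  have e (k : nat) : k%:R / n%:R * n%:R = k%:R :> R by rewrite divfK ?gt_eqF.
  case: i => [_|i iltn]; first by rewrite mul0r g0.
  rewrite (gE i) // e; last by rewrite lexx ler_nat leqnSn.
  by rewrite -natr1 addrAC subrr add0r scale1r addrC subrK.
have g1 : g 1 = g 0 by rewrite -[1](@divff _ n%:R) ?gt_eqF // gi // cn g0.
have [_ /(_ g (continuous_subspaceT cg) Og (esym g1))] := scO.
case=> H [cH HO Hg Hc Hs].
have [e e0 eP] := lebesgue_number cH.
have [M M0 Me] : exists2 M, (0 < M)%N & (M%:R)^-1 < e.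
  exists (Num.truncn e^-1).+1 => //; rewrite -[ltRHS]invrK ltf_pV2 ?posrE ?invr_gt0 //.
  by rewrite truncnS_gt.
(* A multiple of n, so that the centers, reached at times m / n, are mesh points and the mesh
   recovers the cells of the walk. *)
pose N := (n * M)%N.
have N0 : (0 < N)%N by rewrite muln_gt0 n0.
have NR : 0 < N%:R :> R by rewrite ltr0n.
have unit_frac i : (i <= N)%N -> 0 <= (i%:R : R) / N%:R <= 1.
  move=> iN; rewrite divr_ge0 ?ler0n //= ler_pdivrMr // mul1r ler_nat //.
pose f i j := cell_at (c 0%N) (H (i%:R / N%:R, j%:R / N%:R)).
have Sij i j : (i <= N)%N -> (j <= N)%N ->
    (`[0, 1] `*` `[0, 1]) (i%:R / N%:R : R, j%:R / N%:R : R).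
  by move=> iN jN; split; rewrite /= in_itv /= unit_frac.
have OH i j : (i <= N)%N -> (j <= N)%N -> Omega (H (i%:R / N%:R, j%:R / N%:R)).
  by move=> iN jN; apply: HO; exists (i%:R / N%:R, j%:R / N%:R) => //; exact: Sij.
have fc z : z = g 0 -> cell_at (c 0%N) z = c 0%N.
  move=> ->; rewrite g0; apply: cell_at_open; last exact: rect_center_cell.
  exact/open_rect_domain/rect_center_cell.
have sum0 : \big[addb/false]_(0 <= j < N) kappa (f 0%N j) (f 0%N j.+1) = false.
  apply: (@discrete_homotopy f N (c 0%N)).
  - move=> i j iN jN.
    have [v vP] := eP _ (Sij i j (ltnW iN) (ltnW jN)); exists v.
    have close k l : (k == l) || (k.+1 == l) ->
        `|k%:R / N%:R - l%:R / N%:R| < e :> R.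
      case/orP => /eqP <-; first by rewrite subrr normr0.
      rewrite -mulrBl -natr1 opprD addrA subrr sub0r mulN1r normrN.
      rewrite ger0_norm ?invr_ge0 ?ler0n //; apply: le_lt_trans Me.
      rewrite lef_pV2 ?posrE ?ltr0n // ler_nat /N leq_pmull //.
    have corner k l : (i == k) || (i.+1 == k) -> (j == l) || (j.+1 == l) ->
        rect_set (cell (f k l)) v.
      move=> ik jl; have [kN lN] : (k <= N)%N /\ (l <= N)%N by split; lia.
      apply: (vP (k%:R / N%:R, l%:R / N%:R)); first exact: Sij.
      + exact: close.
      + exact: close.
      + exact/cell_atP/OH.
    by split; apply: corner; rewrite eqxx ?orbT.
  - move=> i iN; rewrite /f mul0r (divff (lt0r_neq0 NR)).
    by have [-> ->] := Hs _ (unit_frac i iN); rewrite fc.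
  - by move=> j jN; rewrite /f (divff (lt0r_neq0 NR)) Hc ?fc // unit_frac.
have f0 j : (j <= N)%N -> f 0%N j = cell_at (c 0%N) (g (j%:R / N%:R)).
  by move=> jN; rewrite /f mul0r Hg // unit_frac.
have mesh m l : (m < n)%N -> (l <= M)%N ->
    rect_set (cell (f 0%N (m * M + l)%N)) (w m).
  move=> mn lM; have jN : (m * M + l <= N)%N by rewrite /N; nia.
  rewrite f0 //.
  pose u : R := (m * M + l)%N%:R / N%:R.
  have seg : m%:R <= u * n%:R <= m.+1%:R.
    have -> : u * n%:R = (m * M + l)%N%:R / M%:R.
      rewrite /u /N natrM; field.
      by rewrite !pnatr_eq0 -!lt0n n0 M0.
    have MR : 0 < M%:R :> R by rewrite ltr0n.
    apply/andP; split.
      by rewrite ler_pdivlMr // -natrM ler_nat leq_addr.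
    by rewrite ler_pdivrMr // -natrM ler_nat mulSn addnC leq_add2r.
  have [Og' star] := wP m mn _ seg.
  exact/star/cell_atP.
have fmM m : (m <= n)%N -> f 0%N (m * M)%N = c m.
  move=> mn; rewrite f0 ?leq_mul2r ?mn ?orbT //.
  have -> : (m * M)%N%:R / N%:R = m%:R / n%:R :> R.
    by rewrite /N !natrM; field; rewrite !pnatr_eq0 -!lt0n n0 M0.
  rewrite gi //; apply: cell_at_open; last exact: rect_center_cell.
  exact/open_rect_domain/rect_center_cell.
pose S k := \big[addb/false]_(0 <= j < k) kappa (f 0%N j) (f 0%N j.+1).
(* All mesh cells along segment m contain [w m], so the sum over the segment collapses to [kappa] of
   its end cells, which is 1. *)
have inner m l : (m < n)%N -> (l <= M)%N ->
    S (m * M + l)%N = S (m * M)%N (+) kappa (f 0%N (m * M)%N) (f 0%N (m * M + l)%N).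
  move=> mn; elim: l => [|l IH] lM; first by rewrite addn0 kappa_refl addbF.
  rewrite addnS {1}/S big_nat_recr //= -/(S _) IH 1?ltnW // -addbA.
  rewrite -addnS (@kappa_cocycle _ _ _ (w m)) //.
  - by have := mesh m 0%N mn (leq0n M); rewrite addn0.
  - by apply: mesh => //; exact: ltnW.
  - exact: mesh.
have SmM : forall m, (m <= n)%N -> S (m * M)%N = odd m.
  elim => [_|m IH mn]; first by rewrite mul0n /S big_nil.
  rewrite mulSn addnC inner // IH 1?ltnW // fmM 1?ltnW //.
  have -> : (m * M + M = m.+1 * M)%N by rewrite mulSn addnC.
  by rewrite fmM // kappa_adjacent ?addbT //=; exact: adj.
by rewrite -SmM // /S; rewrite -/N sum0.
Qed.

Lemma adjacent_sym K K' : adjacent_cells K K' -> adjacent_cells K' K.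
Proof. by case; [constructor 2|constructor 1|constructor 4|constructor 3]. Qed.

(** The color is the parity of a chosen path from the root of the adjacency component; evenness of
    closed walks makes it alternate. *)
Lemma exists_coloring : exists s : T -> bool,
  forall K K', adjacent_cells K K' -> s K' = ~~ s K.
Proof.
pose e := [rel K K' | `[< adjacent_cells K K' >]].
have esym : symmetric e by move=> K K'; apply/asboolP/asboolP; exact: adjacent_sym.
have csym := sym_connect_sym esym.
have /choice[q qP] : forall K, exists q,
    path e (fingraph.root e K) q /\ K = last (fingraph.root e K) q.
  move=> K; have : connect e (fingraph.root e K) K by rewrite csym connect_root.
  by case/connectP => q ? ?; exists q.
exists (fun K => odd (size (q K))) => K K' KK'.
have eKK' : e K K' by apply/asboolP.
have rKK' : fingraph.root e K = fingraph.root e K'.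
  by apply/eqP; rewrite (root_connect csym); exact: connect1.
have [pK lK] := qP K; have [pK' lK'] := qP K'.
pose r := fingraph.root e K.
rewrite -rKK' -/r in pK' lK'; rewrite -/r in pK lK.
(* From the root to K, across to K', and back: the length is that of both paths plus one. *)
pose loop := q K ++ K' :: rev (belast r (q K')).
have ploop : path e r loop.
  rewrite cat_path pK -lK andTb.
  apply/andP; split; first exact: eKK'.
  have := rev_path e r (q K'); rewrite -lK' => revE.
  suff : path e K' (rev (belast r (q K'))) by [].
  rewrite revE.
  by apply: sub_path pK' => x y; rewrite esym.
have lloop : last r loop = r.
  rewrite last_cat /=; case: (q K') lK' => [|a s] /=; first by [].
  by rewrite rev_cons last_rcons.
have := @closed_walk_even (nth r (r :: loop)) (size loop).
have -> : odd (size loop) = ~~ (odd (size (q K)) (+) odd (size (q K'))).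
  by rewrite size_cat /= size_rev size_belast addnS /= oddD.
case/(_ _ _)/Wrap => [i iloop||].
- by have /(pathP r)/(_ i iloop)/asboolP := ploop.
- by rewrite nth_last /= lloop.
by rewrite negbK; case: (odd _) (odd _) => [] [].
Qed.

End Coloring.

(** * The checkerboard relation *)

Section MeanSum.
Variable R : realType.

Lemma mean_dn_VEdge_sum (I : finType) (c : I -> R) (q : I -> R * R -> R) x y y' :
  (forall i, is_P2 (q i)) -> y < y' ->
  mean_dn (VEdge x y y') (fun z => \sum_i c i * q i z) =
  \sum_i c i * mean_dn (VEdge x y y') (q i).
Proof.
move=> qP yy; rewrite mean_dn_VEdge //; last exact: is_P2_sum.
rewrite -sumrB mulr_suml; apply: eq_bigr => i _.
by rewrite mean_dn_VEdge //; ring.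
Qed.

Lemma mean_dn_HEdge_sum (I : finType) (c : I -> R) (q : I -> R * R -> R) y x x' :
  (forall i, is_P2 (q i)) -> x < x' ->
  mean_dn (HEdge y x x') (fun z => \sum_i c i * q i z) =
  \sum_i c i * mean_dn (HEdge y x x') (q i).
Proof.
move=> qP yy; rewrite mean_dn_HEdge //; last exact: is_P2_sum.
rewrite -sumrB mulr_suml; apply: eq_bigr => i _.
by rewrite mean_dn_HEdge //; ring.
Qed.

(* The knots l, a, b, r are consecutive and X is the knot sequence of one of the
   three B-splines that do not vanish on [a, b], its i-th interval; the fourth
   knot, if beyond l or r, does not matter. *)
Definition spline_window (l a b r : R) (i : nat) (X : nat -> R) : Prop :=
  match i with
  | 0%N => [/\ X 0%N = a, X 1%N = b & X 2%N = r]
  | 1%N => [/\ X 0%N = l, X 1%N = a, X 2%N = b & X 3%N = r]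
  | _ => [/\ X 1%N = l, X 2%N = a & X 3%N = b]
  end.

(** [e] is 0 or 1 for the left or right end of the i-th interval. *)
Definition alternating_bspline (e i : nat) (X : nat -> R) : R :=
  (-1) ^+ i * (X 2%N - X 1%N) * bspline X (i + e).

Definition alternating_dbspline (e i : nat) (X : nat -> R) : R :=
  (-1) ^+ i * (X 2%N - X 1%N) * dbspline X (i + e).

(** At either end two of the terms are opposite and the third is zero. That each term depends only
    on i, not on the knots outside the window, is what lets the nine-term sum factor, as the patches
    involved may differ there. *)
Lemma alternating_bspline_sum (l a b r : R) (e : nat) : l < a -> a < b -> b < r ->
  (e < 2)%N -> exists2 u : 'I_3 -> R,
  (forall (i : 'I_3) X, spline_window l a b r i X -> alternating_bspline e i X = u i) &
  \sum_i u i = 0.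
Proof.
move=> la ab br e2.
have bl : b - l != 0 by apply/eqP; lra.
have ra : r - a != 0 by apply/eqP; lra.
exists (fun i : 'I_3 => match nat_of_ord i, e with
  | 0%N, 1%N => (r - b) * ((b - a) / (r - a))
  | 1%N, 0%N => - (b - a) * ((a - l) / (b - l))
  | 1%N, 1%N => - (b - a) * ((r - b) / (r - a))
  | 2%N, 0%N => (a - l) * ((b - a) / (b - l))
  | _, _ => 0 end).
  case=> [[|[|[|//]]] /= _] X; case: e e2 => [|[|//]] _ /=;
    rewrite /alternating_bspline /= ?expr0 ?expr1 ?sqrrN ?expr1n ?mulr0 //=.
  - by case=> x0 x1 x2; rewrite ?x0 ?x1 ?x2 mul1r.
  - by case=> x0 x1 x2 x3; rewrite ?x0 ?x1 ?x2 ?x3 mulN1r.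
  - by case=> x0 x1 x2 x3; rewrite ?x0 ?x1 ?x2 ?x3 mulN1r.
  - by case=> x0 x1 x2; rewrite ?x0 ?x1 ?x2 mul1r.
by rewrite !big_ord_recl big_ord0 /=; case: e e2 => [|[|//]] _ /=; field.
Qed.

(** These slopes sum to -2 at the left end and 2 at the right end; edge means cancel through the
    other factor, so only independence of X is recorded. *)
Lemma alternating_dbspline_window (l a b r : R) (e : nat) : (e < 2)%N ->
  exists u : 'I_3 -> R, forall (i : 'I_3) X,
    spline_window l a b r i X -> alternating_dbspline e i X = u i.
Proof.
move=> e2.
exists (fun i : 'I_3 => match nat_of_ord i, e with
  | 0%N, 1%N => (r - b) * (2 / (r - a))
  | 1%N, 0%N => - (b - a) * (2 / (b - l))
  | 1%N, 1%N => - (b - a) * (- 2 / (r - a))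
  | 2%N, 0%N => (a - l) * (- 2 / (b - l))
  | _, _ => 0 end).
case=> [[|[|[|//]]] /= _] X; case: e e2 => [|[|//]] _ /=;
  rewrite /alternating_dbspline /= ?expr0 ?expr1 ?sqrrN ?expr1n ?mulr0 //=.
- by case=> x0 x1 x2; rewrite ?x0 ?x1 ?x2 mul1r.
- by case=> x0 x1 x2 x3; rewrite ?x0 ?x1 ?x2 ?x3 mulN1r.
- by case=> x0 x1 x2 x3; rewrite ?x0 ?x1 ?x2 ?x3 mulN1r.
- by case=> x0 x1 x2; rewrite ?x0 ?x1 ?x2 mul1r.
Qed.

Lemma sum_pair_product (u v : 'I_3 -> R) :
  \sum_(ij : 'I_3 * 'I_3) u ij.1 * v ij.2 = (\sum_i u i) * (\sum_j v j).
Proof.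
rewrite big_distrlr /= pair_big /=; exact: eq_bigr.
Qed.

End MeanSum.

(** * Nine basis functions on one cell *)

Section Relation.
Variables (R : realType) (T : finType) (cell : T -> rect R).
Variable Omega : set (R * R).
Hypothesis grid : rectangular_grid cell Omega.
Hypothesis regO : (closure Omega)° = Omega.
Variable phi : T -> R * R -> R.
Hypothesis phiE : forall K, interior_cell cell Omega K ->
  is_RRM_basis_fun cell K (phi K).
Variable s : T -> bool.
Hypothesis sE : forall K K', adjacent_cells cell K K' -> s K' = ~~ s K.
Implicit Types (K Q : T) (M : nat -> nat -> T).

Let cx := cell_ltx grid.
Let cy := cell_lty grid.

Lemma patch_center K M : is_patch cell K M -> M 1%N 1%N = K.
Proof. by case. Qed.

(** The center and position (i, j) are |i - 1| + |j - 1| steps apart, a number of the parity of i +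
    j. *)
Lemma patch_color K M i j : is_patch cell K M -> (i < 3)%N -> (j < 3)%N ->
  (-1) ^+ s K = (-1) ^+ s (M i j) * ((-1) ^+ i * (-1) ^+ j) :> R.
Proof.
case=> <- L B i3 j3.
have h1 : (-1) ^+ s (M 1%N j) = (-1) ^+ s (M i j) * (-1) ^+ i.+1 :> R.
  case: i i3 => [|[|[|//]]] _.
  - rewrite (sE (K := M 0%N j) (K' := M 1%N j)); last by constructor 1; exact: L.
    by rewrite signrN expr1 mulrN1.
  - by rewrite sqrrN expr1n mulr1.
  - rewrite (sE (K := M 1%N j) (K' := M 2%N j)); last by constructor 1; exact: L.
    by rewrite signrN !exprS expr0; ring.
have h2 : (-1) ^+ s (M 1%N 1%N) = (-1) ^+ s (M 1%N j) * (-1) ^+ j.+1 :> R.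
  case: j j3 {h1} => [|[|[|//]]] _.
  - rewrite (sE (K := M 1%N 0%N) (K' := M 1%N 1%N)); last by constructor 3; exact: B.
    by rewrite signrN expr1 mulrN1.
  - by rewrite sqrrN expr1n mulr1.
  - rewrite (sE (K := M 1%N 1%N) (K' := M 1%N 2%N)); last by constructor 3; exact: B.
    by rewrite signrN !exprS expr0; ring.
by rewrite h2 h1 !exprS; ring.
Qed.

(** Neighbors are unique, so the center can be traced back from the common cell. Hence each position
    of Q belongs to at most one basis function. *)
Lemma patch_position_inj K K' M M' i j : is_patch cell K M -> is_patch cell K' M' ->
  (i < 3)%N -> (j < 3)%N -> M i j = M' i j -> K = K'.
Proof.
move=> pM pM' i3 j3 QQ.
have [_ L B] := pM; have [_ L' B'] := pM'.
have eq1 : M 1%N j = M' 1%N j.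
  case: i i3 QQ => [|[|[|//]]] _ QQ //.
    by apply: (left_of_inj_r grid (L 0%N j isT j3)); rewrite QQ; exact: L'.
  by apply: (left_of_inj_l grid (L 1%N j isT j3)); rewrite QQ; exact: L'.
rewrite -(patch_center pM) -(patch_center pM').
case: j j3 eq1 {QQ} => [|[|[|//]]] _ QQ //.
  by apply: (below_inj_r grid (B 1%N 0%N isT isT)); rewrite QQ; exact: B'.
by apply: (below_inj_l grid (B 1%N 1%N isT isT)); rewrite QQ; exact: B'.
Qed.

(** Uniqueness of the neighbors of Q identifies the knots next to it in both patches; knots farther
    away may differ. *)
Lemma patch_window_x Q K M1 M i j : is_patch cell Q M1 -> is_patch cell K M ->
  (i < 3)%N -> (j < 3)%N -> M i j = Q ->
  spline_window (knotx cell M1 0) (knotx cell M1 1) (knotx cell M1 2)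
    (knotx cell M1 3) i (knotx cell M).
Proof.
move=> pM1 pM i3 j3 QM.
have [_ L1 _] := pM1; have [_ L _] := pM.
have c1 := patch_center pM1.
have kE k : (k < 3)%N -> xl (cell (M k j)) = knotx cell M k /\
    xr (cell (M k j)) = knotx cell M k.+1.
  by move=> k3; have [] := patch_cellE pM k3 j3.
have kE1 k : (k < 3)%N -> xl (cell (M1 k 1%N)) = knotx cell M1 k /\
    xr (cell (M1 k 1%N)) = knotx cell M1 k.+1.
  by move=> k3; have [] := patch_cellE pM1 k3 (isT : 1 < 3)%N.
have [a0 a1] := kE1 0%N isT; have [b0 b1] := kE1 1%N isT; have [d0 d1] := kE1 2%N isT.
have [e0 e1] := kE 0%N isT; have [f0 f1] := kE 1%N isT; have [g0 g1] := kE 2%N isT.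
have right1 H : left_of cell Q H -> H = M1 2%N 1%N.
  move=> QH; apply: (left_of_inj_r grid QH); rewrite -c1; exact: L1.
have left1 H : left_of cell H Q -> H = M1 0%N 1%N.
  move=> QH; apply: (left_of_inj_l grid QH); rewrite -c1; exact: L1.
case: i i3 QM => [|[|[|//]]] _ QM /=.
- have := right1 (M 1%N j); rewrite -{1}QM => /(_ (L 0%N j isT j3)) h.
  by rewrite -e0 -e1 -f1 -d1 -b1 -b0 h QM c1.
- have := right1 (M 2%N j); rewrite -{1}QM => /(_ (L 1%N j isT j3)) h.
  have := left1 (M 0%N j); rewrite -{1}QM => /(_ (L 0%N j isT j3)) h'.
  by rewrite -e0 -f0 -f1 -g1 -d1 -b1 -b0 -a0 h h' QM c1.
- have := left1 (M 1%N j); rewrite -{1}QM => /(_ (L 1%N j isT j3)) h.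
  by rewrite -f0 -g0 -g1 -b1 -b0 -a0 h QM c1.
Qed.

Lemma patch_window_y Q K M1 M i j : is_patch cell Q M1 -> is_patch cell K M ->
  (i < 3)%N -> (j < 3)%N -> M i j = Q ->
  spline_window (knoty cell M1 0) (knoty cell M1 1) (knoty cell M1 2)
    (knoty cell M1 3) j (knoty cell M).
Proof.
move=> pM1 pM i3 j3 QM.
have [_ _ L1] := pM1; have [_ _ L] := pM.
have c1 := patch_center pM1.
have kE k : (k < 3)%N -> yb (cell (M i k)) = knoty cell M k /\
    yt (cell (M i k)) = knoty cell M k.+1.
  by move=> k3; have [] := patch_cellE pM i3 k3.
have kE1 k : (k < 3)%N -> yb (cell (M1 1%N k)) = knoty cell M1 k /\
    yt (cell (M1 1%N k)) = knoty cell M1 k.+1.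
  by move=> k3; have [] := patch_cellE pM1 (isT : 1 < 3)%N k3.
have [a0 a1] := kE1 0%N isT; have [b0 b1] := kE1 1%N isT; have [d0 d1] := kE1 2%N isT.
have [e0 e1] := kE 0%N isT; have [f0 f1] := kE 1%N isT; have [g0 g1] := kE 2%N isT.
have right1 H : below cell Q H -> H = M1 1%N 2%N.
  move=> QH; apply: (below_inj_r grid QH); rewrite -c1; exact: L1.
have left1 H : below cell H Q -> H = M1 1%N 0%N.
  move=> QH; apply: (below_inj_l grid QH); rewrite -c1; exact: L1.
case: j j3 QM {kE} => [|[|[|//]]] _ QM /=.
- have := right1 (M i 1%N); rewrite -{1}QM => /(_ (L i 0%N i3 isT)) h.
  by rewrite -e0 -e1 -f1 -d1 -b1 -b0 h QM c1.
- have := right1 (M i 2%N); rewrite -{1}QM => /(_ (L i 1%N i3 isT)) h.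
  have := left1 (M i 0%N); rewrite -{1}QM => /(_ (L i 0%N i3 isT)) h'.
  by rewrite -e0 -f0 -f1 -g1 -d1 -b1 -b0 -a0 h h' QM c1.
- have := left1 (M i 1%N); rewrite -{1}QM => /(_ (L i 1%N i3 isT)) h.
  by rewrite -f0 -g0 -g1 -b1 -b0 -a0 h QM c1.
Qed.

Definition checkerboard K : R :=
  (-1) ^+ s K * (rlen (cell K) * rheight (cell K)).

Lemma checkerboard_neq0 K : checkerboard K != 0.
Proof.
have h1 := cx K; have h2 := cy K.
by rewrite /checkerboard mulf_neq0 ?signr_eq0 // mulf_neq0 //;
  rewrite /rlen /rheight subr_eq0 gt_eqF.
Qed.

Lemma checkerboard_patch K M i j : is_patch cell K M -> (i < 3)%N -> (j < 3)%N ->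
  checkerboard K = (-1) ^+ s (M i j) *
    (((-1) ^+ i * (knotx cell M 2 - knotx cell M 1)) *
     ((-1) ^+ j * (knoty cell M 2 - knoty cell M 1))).
Proof.
move=> pM i3 j3; rewrite /checkerboard (patch_color pM i3 j3).
have [k1 k2 k3 k4] := patch_cellE pM (isT : 1 < 3)%N (isT : 1 < 3)%N.
rewrite (patch_center pM) in k1 k2 k3 k4.
by rewrite /rlen /rheight k1 k2 k3 k4; ring.
Qed.

Lemma patch_cells_support K M Q : is_patch cell K M ->
  (forall z, ~ patch_domain cell M z -> phi K z = 0) ->
  rect_set (cell Q) `<=` support_fun (phi K) -> patch_cells M Q.
Proof.
move=> pM phi0 QS; apply: contrapT => MQ.
have Qc : open_rect (cell Q) (rect_center (cell Q)) by apply: rect_center_open.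
have /QS : rect_set (cell Q) (rect_center (cell Q)) by exact: open_rect_sub.
rewrite /support_fun; suff sub : closure [set z | phi K z != 0] `<=` patch_domain cell M.
  move=> /sub Dz; have : set0 (rect_center (cell Q)) by rewrite -(patch_disjoint grid MQ).
  by [].
have cD : closed (patch_domain cell M).
  by rewrite (patch_domainE cx cy pM); exact: closed_rect_set.
rewrite closureE; apply: smallest_sub => // z /= /eqP pz.
by apply: contrapT => /phi0.
Qed.

(* Vertex values and edge means of the alternating sum factor into
   one-dimensional alternating sums of B-splines, which vanish at the knots. *)
Lemma checkerboard_relation Q :
  #|[set K | `[< interior_cell cell Omega K /\
       rect_set (cell Q) `<=` support_fun (phi K) >]]%SET| = 9%N ->
  \forall z \ae leb2 R, rect_set (cell Q) z ->
    \sum_(K | `[< interior_cell cell Omega K >]) checkerboard K * phi K z = 0.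
Proof.
set A := [set K | _]%SET => cardA.
have /choice[M MP] : forall K, exists M, interior_cell cell Omega K ->
    [/\ is_patch cell K M, forall z, ~ patch_domain cell M z -> phi K z = 0 &
    exists p, RRM_pieces cell (patch_domain cell M) (patch_cells M) (phi K) p /\
      p K (xl (cell K), yb (cell K)) =
      rlen (cell (M 0%N 1%N)) / (rlen (cell (M 0%N 1%N)) + rlen (cell K)) *
      (rheight (cell (M 1%N 0%N)) /
      (rheight (cell (M 1%N 0%N)) + rheight (cell K)))].
  move=> K; have [/phiE[M [pM [phi0 pP]]]|] := pselect (interior_cell cell Omega K).
    by exists M.
  by exists (fun _ _ => K).
have /choice[p pP] : forall K, exists p, interior_cell cell Omega K ->
    RRM_pieces cell (patch_domain cell (M K)) (patch_cells (M K)) (phi K) p /\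
      p K (xl (cell K), yb (cell K)) =
      rlen (cell (M K 0%N 1%N)) / (rlen (cell (M K 0%N 1%N)) + rlen (cell K)) *
      (rheight (cell (M K 1%N 0%N)) /
      (rheight (cell (M K 1%N 0%N)) + rheight (cell K))).
  move=> K; have [/MP[_ _ [p ?]]|] := pselect (interior_cell cell Omega K).
    by exists p.
  by exists (fun _ _ => 0).
have /choice[pos posP] : forall K, exists ij : 'I_3 * 'I_3,
    patch_cells (M K) Q -> M K ij.1 ij.2 = Q.
  move=> K; have [[i [j [i3 j3 ->]]]|] := pselect (patch_cells (M K) Q).
    by exists (Ordinal i3, Ordinal j3).
  by exists (ord0, ord0).
have Aint K : K \in A -> interior_cell cell Omega K /\ patch_cells (M K) Q.
  rewrite inE => /asboolP[Kint QS]; split => //.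
  by have [pM phi0 _] := MP K Kint; exact: patch_cells_support QS.
have pos_inj K K' : interior_cell cell Omega K -> interior_cell cell Omega K' ->
    patch_cells (M K) Q -> patch_cells (M K') Q -> pos K = pos K' -> K = K'.
  move=> Ki K'i KQ K'Q e; have [pM _ _] := MP K Ki; have [pM' _ _] := MP K' K'i.
  apply: (patch_position_inj pM pM' (ltn_ord (pos K).1) (ltn_ord (pos K).2)).
  by rewrite posP // e posP.
(* Nine functions at distinct positions fill all nine positions. *)
have posA : [set pos K | K in A]%SET = [set: 'I_3 * 'I_3]%SET.
  apply/eqP; rewrite eqEcard finset.subsetT /= cardsT card_prod card_ord.
  rewrite card_in_imset ?cardA // => K K' /Aint[Ki KQ] /Aint[K'i K'Q].
  exact: pos_inj.
have /choice[h hP] : forall ij, exists K, K \in A /\ pos K = ij.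
  move=> ij; have : ij \in [set pos K | K in A]%SET by rewrite posA inE.
  by case/imsetP => K KA ->; exists K.
have hint ij : interior_cell cell Omega (h ij) by case: (Aint _ (hP ij).1).
have hQ ij : M (h ij) ij.1 ij.2 = Q.
  by rewrite -{2 3}(hP ij).2 posP //; case: (Aint _ (hP ij).1).
have hpatch ij : is_patch cell (h ij) (M (h ij)) by case: (MP _ (hint ij)).
(* The function having Q at its central position is that of Q itself, so Q has a patch, whose knots
   are the common reference. *)
pose c11 : 'I_3 * 'I_3 := (Ordinal (isT : 1 < 3)%N, Ordinal (isT : 1 < 3)%N).
pose M1 := M (h c11).
have pM1 : is_patch cell Q M1.
  have <- : h c11 = Q by rewrite -(patch_center (hpatch c11)) -[RHS](hQ c11).
  exact: hpatch.
have wx (ij : 'I_3 * 'I_3) : spline_window (knotx cell M1 0)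
    (knotx cell M1 1) (knotx cell M1 2)
    (knotx cell M1 3) ij.1 (knotx cell (M (h ij))).
  exact: (patch_window_x pM1 (hpatch ij) (ltn_ord _) (ltn_ord _) (hQ ij)).
have wy (ij : 'I_3 * 'I_3) : spline_window (knoty cell M1 0)
    (knoty cell M1 1) (knoty cell M1 2)
    (knoty cell M1 3) ij.2 (knoty cell (M (h ij))).
  exact: (patch_window_y pM1 (hpatch ij) (ltn_ord _) (ltn_ord _) (hQ ij)).
have lx k : (k < 3)%N -> knotx cell M1 k < knotx cell M1 k.+1.
  exact: (knotx_lt cx pM1).
have ly k : (k < 3)%N -> knoty cell M1 k < knoty cell M1 k.+1.
  exact: (knoty_lt cy pM1).
have Qc (ij : 'I_3 * 'I_3) : [/\ xl (cell Q) = knotx cell (M (h ij)) ij.1,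
    xr (cell Q) = knotx cell (M (h ij)) ij.1.+1,
    yb (cell Q) = knoty cell (M (h ij)) ij.2 &
    yt (cell Q) = knoty cell (M (h ij)) ij.2.+1].
  have [<- <- <- <-] := patch_cellE (hpatch ij) (ltn_ord ij.1) (ltn_ord ij.2).
  by rewrite hQ.
have pieces ij := (pP _ (hint ij)).1.
have pval ij := (pP _ (hint ij)).2.
have cE (ij : 'I_3 * 'I_3) : checkerboard (h ij) = (-1) ^+ s Q *
    (((-1) ^+ ij.1 * (knotx cell (M (h ij)) 2 - knotx cell (M (h ij)) 1)) *
     ((-1) ^+ ij.2 * (knoty cell (M (h ij)) 2 - knoty cell (M (h ij)) 1))).
  by rewrite (checkerboard_patch (hpatch ij) (ltn_ord ij.1) (ltn_ord ij.2)) hQ.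
pose q z := \sum_ij checkerboard (h ij) * p (h ij) Q z.
have qP ij : is_P2 (p (h ij) Q).
  rewrite -(hQ ij); exact: (patch_P2 (pieces ij)).
have [ux0 ux0P sx0] :=
  @alternating_bspline_sum R _ _ _ _ 0 (lx 0%N isT) (lx 1%N isT) (lx 2%N isT) isT.
have [ux1 ux1P sx1] :=
  @alternating_bspline_sum R _ _ _ _ 1 (lx 0%N isT) (lx 1%N isT) (lx 2%N isT) isT.
have [uy0 uy0P sy0] :=
  @alternating_bspline_sum R _ _ _ _ 0 (ly 0%N isT) (ly 1%N isT) (ly 2%N isT) isT.
have [uy1 uy1P sy1] :=
  @alternating_bspline_sum R _ _ _ _ 1 (ly 0%N isT) (ly 1%N isT) (ly 2%N isT) isT.
have /choice[dx dxP] : forall e, exists u : 'I_3 -> R, (e < 2)%N ->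
    forall (i : 'I_3) X, spline_window (knotx cell M1 0) (knotx cell M1 1)
      (knotx cell M1 2) (knotx cell M1 3) i X -> alternating_dbspline e i X = u i.
  move=> e; have [e2|_] := ltnP e 2; last by exists (fun=> 0).
  by have [u uP] := @alternating_dbspline_window R (knotx cell M1 0) (knotx cell M1 1)
      (knotx cell M1 2) (knotx cell M1 3) e e2; exists u.
have /choice[dy dyP] : forall e, exists u : 'I_3 -> R, (e < 2)%N ->
    forall (i : 'I_3) X, spline_window (knoty cell M1 0) (knoty cell M1 1)
      (knoty cell M1 2) (knoty cell M1 3) i X -> alternating_dbspline e i X = u i.
  move=> e; have [e2|_] := ltnP e 2; last by exists (fun=> 0).
  by have [u uP] := @alternating_dbspline_window R (knoty cell M1 0) (knoty cell M1 1)
      (knoty cell M1 2) (knoty cell M1 3) e e2; exists u.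
pose ux e := if e == 0%N then ux0 else ux1.
pose uy e := if e == 0%N then uy0 else uy1.
have uxP e (ij : 'I_3 * 'I_3) : (e < 2)%N ->
    alternating_bspline e ij.1 (knotx cell (M (h ij))) = ux e ij.1.
  by case: e => [|[|//]] _; [exact: ux0P | exact: ux1P].
have uyP e (ij : 'I_3 * 'I_3) : (e < 2)%N ->
    alternating_bspline e ij.2 (knoty cell (M (h ij))) = uy e ij.2.
  by case: e => [|[|//]] _; [exact: uy0P | exact: uy1P].
have sx e : \sum_i ux e i = 0 by rewrite /ux; case: ifP.
have sy e : \sum_i uy e i = 0 by rewrite /uy; case: ifP.
have corner e e' x y : (e < 2)%N -> (e' < 2)%N ->
    (forall ij : 'I_3 * 'I_3, x = knotx cell (M (h ij)) (ij.1 + e)) ->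
    (forall ij : 'I_3 * 'I_3, y = knoty cell (M (h ij)) (ij.2 + e')) -> q (x, y) = 0.
  move=> e2 e'2 xE yE; rewrite /q.
  transitivity (\sum_ij (-1) ^+ s Q * (ux e ij.1 * uy e' ij.2)).
    apply: eq_bigr => ij _; rewrite -(uxP e ij) // -(uyP e' ij) // cE.
    rewrite (xE ij) (yE ij).
    have -> : p (h ij) Q = p (h ij) (M (h ij) ij.1 ij.2) by rewrite hQ.
    rewrite (basis_vertexE cx cy (hpatch ij) (pieces ij) (pval ij)) //.
    by rewrite /alternating_bspline; ring.
  by rewrite -mulr_sumr sum_pair_product sx mul0r mulr0.
have vedge e x : (e < 2)%N ->
    (forall ij : 'I_3 * 'I_3, x = knotx cell (M (h ij)) (ij.1 + e)) ->
    mean_dn (VEdge x (yb (cell Q)) (yt (cell Q))) q = 0.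
  move=> e2 xE; rewrite /q mean_dn_VEdge_sum //.
  transitivity (\sum_ij (-1) ^+ s Q *
     (dx e ij.1 * ((uy 0%N ij.2 + uy 1%N ij.2) / 2))).
    apply: eq_bigr => ij _.
    rewrite -(dxP e e2 _ _ (wx ij)) -(uyP 0%N ij) // -(uyP 1%N ij) // cE.
    have [_ _ -> ->] := Qc ij; rewrite (xE ij).
    have -> : p (h ij) Q = p (h ij) (M (h ij) ij.1 ij.2) by rewrite hQ.
    rewrite (basis_VEdgeE cx cy (hpatch ij) (pieces ij) (pval ij)) //.
    by rewrite /alternating_bspline /alternating_dbspline addn0 addn1; ring.
  rewrite -mulr_sumr (sum_pair_product _ (fun j => (uy 0%N j + uy 1%N j) / 2)).
  by rewrite -mulr_suml big_split /= !sy addr0 mul0r !mulr0.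
have hedge e y : (e < 2)%N ->
    (forall ij : 'I_3 * 'I_3, y = knoty cell (M (h ij)) (ij.2 + e)) ->
    mean_dn (HEdge y (xl (cell Q)) (xr (cell Q))) q = 0.
  move=> e2 yE; rewrite /q mean_dn_HEdge_sum //.
  transitivity (\sum_ij (-1) ^+ s Q *
     (((ux 0%N ij.1 + ux 1%N ij.1) / 2) * dy e ij.2)).
    apply: eq_bigr => ij _.
    rewrite -(dyP e e2 _ _ (wy ij)) -(uxP 0%N ij) // -(uxP 1%N ij) // cE.
    have [-> -> _ _] := Qc ij; rewrite (yE ij).
    have -> : p (h ij) Q = p (h ij) (M (h ij) ij.1 ij.2) by rewrite hQ.
    rewrite (basis_HEdgeE cx cy (hpatch ij) (pieces ij) (pval ij)) //.
    by rewrite /alternating_bspline /alternating_dbspline addn0 addn1; ring.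
  rewrite -mulr_sumr (sum_pair_product (fun i => (ux 0%N i + ux 1%N i) / 2)).
  by rewrite -mulr_suml big_split /= !sx addr0 !mul0r mulr0.
have xlE (ij : 'I_3 * 'I_3) : xl (cell Q) = knotx cell (M (h ij)) (ij.1 + 0).
  by rewrite addn0; case: (Qc ij).
have xrE (ij : 'I_3 * 'I_3) : xr (cell Q) = knotx cell (M (h ij)) (ij.1 + 1).
  by rewrite addn1; case: (Qc ij).
have ybE (ij : 'I_3 * 'I_3) : yb (cell Q) = knoty cell (M (h ij)) (ij.2 + 0).
  by rewrite addn0; case: (Qc ij).
have ytE (ij : 'I_3 * 'I_3) : yt (cell Q) = knoty cell (M (h ij)) (ij.2 + 1).
  by rewrite addn1; case: (Qc ij).
have q0 : forall z, q z = 0.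
  apply: (@P2_unisolvent _ q (xl (cell Q)) (xr (cell Q)) (yb (cell Q)) (yt (cell Q))) => //.
  - exact: is_P2_sum.
  - exact: (corner 0%N 0%N).
  - exact: (corner 1%N 0%N).
  - exact: (corner 0%N 1%N).
  - exact: (corner 1%N 1%N).
  - exact: (vedge 0%N).
  - exact: (vedge 1%N).
  - exact: (hedge 0%N).
  - exact: (hedge 1%N).
have pieceE : forall ij, \forall z \ae leb2 R,
    rect_set (cell Q) z -> phi (h ij) z = p (h ij) Q z.
  move=> ij; have [_ /(_ Q) + _ _ _] := pieces ij.
  by case => //; exists ij.1, ij.2; rewrite hQ; split.
apply: leb2_aeS (leb2_aeI (ae_open_rect (cell Q)) (leb2_ae_forall pieceE)) => z.
move=> [/[swap] h2 /[swap] Qz /(_ Qz) Qoz].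
(* A cell outside A whose patch contained Q would share its position with a member of A; so all
   other functions vanish on the open cell. *)
rewrite (bigID (fun K => K \in A)) /= [X in _ + X]big1 ?addr0; last first.
  move=> K /andP[/asboolP Kint KA].
  have [_ phi0 _] := MP K Kint.
  rewrite (basis_fun_out grid phi0 _ Qoz) ?mulr0 // => KQ.
  have [hA hpos] := hP (pos K); have [hi hQ'] := Aint _ hA.
  by case/negP: KA; rewrite -(pos_inj _ _ hi Kint hQ' KQ hpos).
rewrite (reindex_onto h pos) /=; last first.
  move=> K /andP[/asboolP Kint KA].
  have [hA hpos] := hP (pos K); have [hi hQ'] := Aint _ hA.
  by apply: pos_inj => //; case: (Aint _ KA).
rewrite -[RHS](q0 z) /q; apply: eq_big => ij; last by move=> _; rewrite h2.
have [hA ->] := hP ij; rewrite hA eqxx !andbT; exact/asboolP.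
Qed.

End Relation.

(** * Linear functionals on combinations, and the contradiction *)

Section LinearCombination.
Variables (R : realType) (T : finType) (X : set (R * R -> R)).
Variable l : (R * R -> R) -> R.
Hypothesis linX : is_linear_space X.
Hypothesis linl : linear_on X l.

Lemma linear_on0 : l (fun=> 0) = 0.
Proof.
have [X0 _] := linX; have := linl 1 X0 X0.
rewrite (_ : (fun z => _) = (fun=> 0)); last first.
  by apply/funext => z; rewrite mulr0 addr0.
by move=> h; lra.
Qed.

Lemma linear_on_sum (P : pred T) (c : T -> R) (phi : T -> R * R -> R) :
  (forall K, P K -> X (phi K)) ->
  X (fun z => \sum_(K | P K) c K * phi K z) /\
  l (fun z => \sum_(K | P K) c K * phi K z) = \sum_(K | P K) c K * l (phi K).
Proof.
move=> phiX; elim: (index_enum T) => [|K r [IH1 IH2]].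
  have e : (fun z => \sum_(K <- [::] | P K) c K * phi K z) = (fun=> 0).
    by apply/funext => z; rewrite big_nil.
  by rewrite e big_nil linear_on0; split => //; case: linX.
case: (boolP (P K)) => PK; last first.
  have e : (fun z => \sum_(L <- K :: r | P L) c L * phi L z) =
           (fun z => \sum_(L <- r | P L) c L * phi L z).
    by apply/funext => z; rewrite big_cons (negPf PK).
  by rewrite e big_cons (negPf PK).
have e : (fun z => \sum_(L <- K :: r | P L) c L * phi L z) =
         (fun z => c K * phi K z + \sum_(L <- r | P L) c L * phi L z).
  by apply/funext => z; rewrite big_cons PK.
rewrite e big_cons PK -IH2; split; last by rewrite linl //; exact: phiX.
by case: linX => _; apply => //; exact: phiX.
Qed.

End LinearCombination.

Unset Implicit Arguments.

Theorem theoremA4 (R : realType) (Omega : set (R * R))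
  (T : finType) (cell : T -> rect R)
  (polyOmega : polygonal_domain Omega)
  (scOmega : simply_connected Omega)
  (gridOmega : rectangular_grid cell Omega)
  (cornersOmega : corner_separated cell Omega)
  (phi : T -> R * R -> R)
  (phiE : forall K, interior_cell cell Omega K ->
     is_RRM_basis_fun cell K (phi K))
  (X : set (R * R -> R))
  (linX : is_linear_space X)
  (VX : RRM cell Omega [set: T] `<=` X)
  (D : T -> set (R * R))
  (DOmega : forall K, interior_cell cell Omega K -> D K `<=` Omega)
  (lambda : T -> (R * R -> R) -> R)
  (lambda_lin : forall K, interior_cell cell Omega K -> linear_on X (lambda K))
  (lambda_loc : forall K, interior_cell cell Omega K ->
     determined_on X (D K) (lambda K))
  (K0 : T) (K0int : interior_cell cell Omega K0)
  (complete_K0 : completely_subdomain cell phi Omega (D K0)) :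
  ~ (forall w, RRM cell Omega [set: T] w ->
       ae_eq (leb2 R) Omega (interpolation cell phi Omega lambda w) w).
Proof.
move=> proj.
have regO : (closure Omega)° = Omega by case: polyOmega => _ _ _ _ [].
have [s sE] := exists_coloring gridOmega regO scOmega.
have phiV K : interior_cell cell Omega K -> RRM cell Omega [set: T] (phi K).
  by move=> /phiE; exact: RRM_basis_fun.
have dual K : interior_cell cell Omega K -> lambda K0 (phi K) = (K0 == K)%:R.
  move=> Kint; apply/eqP; rewrite -subr_eq0; apply/eqP.
  (* Reproducing [phi K] means that the combination of the [phi L] with these coefficients vanishes
     almost everywhere. *)
  apply: (basis_independent gridOmega regO phiE
    (d := fun L => lambda L (phi K) - (L == K)%:R)) => //.
  apply: leb2_aeS (proj _ (phiV K Kint)) => z h Oz.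
  under eq_bigr do rewrite mulrBl.
  rewrite sumrB; apply/eqP; rewrite subr_eq0; apply/eqP.
  rewrite [LHS]h // (bigD1 K) /=; last exact/asboolP.
  rewrite eqxx mul1r big1 ?addr0 // => L /andP[_ /negPf ->].
  by rewrite mul0r.
pose f z := \sum_(K | `[< interior_cell cell Omega K >])
  checkerboard cell s K * phi K z.
have phiX K : `[< interior_cell cell Omega K >] -> X (phi K).
  by move=> /asboolP Kint; exact/VX/phiV.
have [fX lf] := linear_on_sum linX (lambda_lin K0 K0int) (checkerboard cell s) phiX.
have f0 : ae_eq (leb2 R) (D K0) f (fun=> 0).
  case: complete_K0 => S [_ -> S9].
  have SP Q : \forall z \ae leb2 R, Q \in S -> rect_set (cell Q) z -> f z = 0.
    case: (boolP (Q \in S)) => QS; last by apply: leb2_aeS (ae_open_rect (cell Q)).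
    have h := checkerboard_relation gridOmega phiE sE (S9 Q QS).
    by apply: leb2_aeS h => z h _; exact: h.
  apply: leb2_aeS (leb2_ae_forall SP) => z h [Q /= QS Qz].
  exact: (h Q).
(* Locality equates the value on f with the value on zero, while duality extracts the coefficient at
   K0. *)
have := lambda_loc K0 K0int _ _ fX (linX.1) f0.
rewrite (linear_on0 linX (lambda_lin K0 K0int)) [LHS]lf.
rewrite (bigD1 K0) /=; last exact/asboolP.
rewrite dual // eqxx mulr1 big1 ?addr0; last first.
  move=> K /andP[/asboolP Kint K0K].
  by rewrite dual // eq_sym (negPf K0K) mulr0.
by move/eqP; apply/negP; exact: (checkerboard_neq0 gridOmega).
Qed.
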